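(* Let $\widehat u$ be the solution of the approximate problem with load $\widehat W$, and let $(U^m)_{m=0}^M$ be the Crank-Nicolson time-discrete approximations of $\widehat u$, given by $U^0:=0$ and, for $m=1,\dots,M$, by $U^m\in\dot H^4(D)$ such that $$U^m-U^{m-1}+\tfrac{\Delta\tau}{2}\,\partial_x^4\big(U^m+U^{m-1}\big)=\int_{\tau_{m-1}}^{\tau_m}\widehat W(s,\cdot)\,ds\quad\text{a.s.}$$ Then there exists a constant $C>0$, independent of $\Delta t$, ${\sf M}_\star$ and $\Delta\tau$, such that $$\max_{1\le m\le M}\Big(\mathbb E\big[\|U^m-\widehat u(\tau_m,\cdot)\|_{L^2(D)}^2\big]\Big)^{1/2}\le C\,\epsilon^{-\frac12}\,\Delta\tau^{\frac38-\epsilon}\qquad\forall\,\epsilon\in\left(0,\tfrac38\right].$$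
   Context: $T>0$ is fixed, $D=(0,1)$, $(\Omega,\mathcal F,P)$ is a complete probability space, $\mathbb E$ is expectation, $\dot W$ is a space-time white noise on $[0,T]\times D$, and $\int\int\Phi\,dW$ denotes the Wiener integral of a deterministic $\Phi\in L^2((0,T)\times D)$. For $k\in\mathbb N=\{1,2,\dots\}$: $\lambda_k:=k\pi$, $\varepsilon_k(z):=\sqrt2\sin(\lambda_k z)$, $G(t;x,y):=\sum_{k=1}^\infty e^{-\lambda_k^4t}\varepsilon_k(x)\varepsilon_k(y)$. $\dot H^4(D):=\{g\in L^2(D):\sum_k\lambda_k^8(g,\varepsilon_k)_{L^2(D)}^2<\infty\}=\{g\in H^4(D): g=g''=0\text{ on }\partial D\}$. Approximate problem: let ${\sf M}_\star,{\sf N}_\star\in\mathbb N$, $\Delta t:=T/{\sf N}_\star$, $t_n:=n\Delta t$, $T_n:=(t_{n-1},t_n)$, ${\sf R}_i^n:=\int_{T_n}\int_D\varepsilon_i(x)\,dW(t,x)$ (independent $N(0,\Delta t)$ random variables), and $\widehat W(t,x):=\tfrac1{\Delta t}\sum_{i=1}^{{\sf M}_\star}{\sf R}_i^n\varepsilon_i(x)$ for $t\in T_n$, $x\in D$, $n=1,\dots,{\sf N}_\star$. $\widehat u$ solves $\widehat u_t+\widehat u_{xxxx}=\widehat W$ in $(0,T]\times D$, $\widehat u=\widehat u_{xx}=0$ on $\partial D$, $\widehat u(0,\cdot)=0$; equivalently $\widehat u(t,x)=\int_0^t\int_DG(t-s;x,y)\widehat W(s,y)\,dy\,ds$. Time grid: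 $M\in\mathbb N$, $\Delta\tau:=T/M$, $\tau_m:=m\Delta\tau$ (unrelated to the grid $t_n$). *)

(* Defs.v *)
From HB Require Import structures.
From mathcomp Require Import all_boot all_order all_algebra.
From mathcomp Require Import all_classical all_reals all_analysis.

Set Implicit Arguments.
Unset Strict Implicit.
Unset Printing Implicit Defensive.

Import Order.TTheory GRing.Theory Num.Theory.
Import numFieldNormedType.Exports.

Local Open Scope classical_set_scope.
Local Open Scope ring_scope.

Notation leb := lebesgue_measure.

Definition dom (R : realType) : set R := `]0, 1[.
Arguments dom : clear implicits.

Definition dom_T (R : realType) (T : R) : set (R * R) := `]0, T[ `*` dom R.

Definition inL2 (R : realType) (g : R -> R) : Prop :=
  measurable_fun (dom R) g /\
  (\int[leb]_(x in dom R) ((g x) ^+ 2)%:E < +oo)%E.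

Definition L2_inner (R : realType) (f g : R -> R) : R :=
  \int[leb]_(x in dom R) (f x * g x).

Definition L2_norm (R : realType) (g : R -> R) : \bar R :=
  ((\int[leb]_(x in dom R) ((g x) ^+ 2)%:E) `^ 2^-1)%E.

Definition lambda (R : realType) (k : nat) : R := k%:R * pi.
Arguments lambda : clear implicits.

Definition vareps (R : realType) (k : nat) (z : R) : R :=
  Num.sqrt 2 * sin (lambda R k * z).

(* The series diverges in general for t <= 0, where the value of green is
   irrelevant. *)
Definition green (R : realType) (t x y : R) : R :=
  limn (fun n => \sum_(1 <= k < n)
    (expR (- (lambda R k ^+ 4 * t)) * vareps k x * vareps k y)).

Definition dotH4 (R : realType) (g : R -> R) : Prop :=
  inL2 g /\
  (\sum_(1 <= k <oo)
    ((lambda R k ^+ 8 * (L2_inner g (vareps k)) ^+ 2)%:E) < +oo)%E.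

(* C_c^oo(D) *)
Definition test_function (R : realType) (phi : R -> R) : Prop :=
  (forall (n : nat) (x : R), derivable (derive1n n phi) x 1) /\
  (exists a b : R, [/\ 0 < a, b < 1 &
     forall x, ~ (a <= x /\ x <= b) -> phi x = 0]).

(* h in L^2(D) is the weak fourth derivative of g on D. *)
Definition weak_deriv4 (R : realType) (g h : R -> R) : Prop :=
  inL2 h /\
  forall phi, test_function phi -> L2_inner g (derive1n 4 phi) = L2_inner h phi.

(* A real random variable with a normal law; degenerate (constant) laws are
   included separately because normal_prob m 0 is not a Dirac mass. *)
Definition gaussian_rv d (Omega : measurableType d) (R : realType)
    (P : probability Omega R) (X : Omega -> R) : Prop :=
  (exists m : R, {ae P, forall w, X w = m}) \/
  (exists m s : R, 0 < s /\
     forall A : set R, measurable A -> P (X @^-1` A) = normal_prob m s A).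

Definition inL2_T (R : realType) (T : R) (Phi : R * R -> R) : Prop :=
  measurable_fun (dom_T T) Phi /\
  (\int[(leb \x leb)%E]_(z in dom_T T) ((Phi z) ^+ 2)%:E < +oo)%E.

(* Space-time white noise on [0,T] x D as the isonormal Gaussian process
   over L^2((0,T) x D): W Phi is the Wiener integral of Phi, with Phi a function
   of (t, x). Almost sure linearity of W follows from the covariance. *)
Definition white_noise d (Omega : measurableType d) (R : realType)
    (P : probability Omega R) (T : R) (W : (R * R -> R) -> {RV P >-> R}) : Prop :=
  [/\ (forall (n : nat) (c : 'I_n -> R) (Phi : 'I_n -> R * R -> R),
         (forall i, inL2_T T (Phi i)) ->
         gaussian_rv P (fun w => \sum_(i < n) c i * W (Phi i) w)),
      (forall Phi, inL2_T T Phi -> ('E_P[W Phi] = 0)%E) &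
      (forall Phi Psi, inL2_T T Phi -> inL2_T T Psi ->
         covariance P (W Phi) (W Psi) =
         (\int[(leb \x leb)%E]_(z in dom_T T) ((Phi z * Psi z)%:E))%E)].

Definition grid (R : realType) (T : R) (N n : nat) : R := n%:R * (T / N%:R).

Definition grid_cell (R : realType) (T : R) (N n : nat) : set R :=
  `]grid T N n.-1, grid T N n[.

(* R_i^n *)
Definition noise_incr d (Omega : measurableType d) (R : realType)
    (P : probability Omega R) (W : (R * R -> R) -> {RV P >-> R})
    (T : R) (N i n : nat) : {RV P >-> R} :=
  W (fun z => \1_(grid_cell T N n) z.1 * vareps i z.2).

(* Set to 0 at the grid points t_n. *)
Definition What d (Omega : measurableType d) (R : realType)
    (P : probability Omega R) (W : (R * R -> R) -> {RV P >-> R})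
    (T : R) (Mstar Nstar : nat) (w : Omega) (t x : R) : R :=
  \sum_(1 <= n < Nstar.+1) \1_(grid_cell T Nstar n) t *
    ((T / Nstar%:R)^-1 *
     \sum_(1 <= i < Mstar.+1) noise_incr W T Nstar i n w * vareps i x).

Definition uhat d (Omega : measurableType d) (R : realType)
    (P : probability Omega R) (W : (R * R -> R) -> {RV P >-> R})
    (T : R) (Mstar Nstar : nat) (w : Omega) (t x : R) : R :=
  \int[leb]_(s in `]0, t[)
    \int[leb]_(y in dom R)
      (green (t - s) x y * What W T Mstar Nstar w s y).

(* One Crank-Nicolson step for v_t + v_xxxx = f over (a, b), from v0 at time a
   to v1 at time b; h is the weak fourth derivative of v1 + v0. *)
Definition CN_step (R : realType) (f : R -> R -> R) (a b : R)
    (v0 v1 : R -> R) : Prop :=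
  exists h : R -> R,
    weak_deriv4 (fun x => v1 x + v0 x) h /\
    {ae leb, forall x, dom R x ->
       v1 x - v0 x + (b - a) / 2 * h x = \int[leb]_(s in `]a, b[) f s x}.

(* U m w x with U 0 = 0 *)
Definition crank_nicolson d (Omega : measurableType d) (R : realType)
    (P : probability Omega R) (T : R) (M : nat)
    (f : Omega -> R -> R -> R) (U : nat -> Omega -> R -> R) : Prop :=
  (forall w x, U 0%N w x = 0) /\
  (forall m : nat, (1 <= m <= M)%N ->
     {ae P, forall w, dotH4 (U m w) /\
        CN_step (f w) (grid T M m.-1) (grid T M m) (U m.-1 w) (U m w)}).

(* Main.v *)
Require Import Defs.
From mathcomp Require Import all_boot all_order all_algebra.
From mathcomp Require Import all_classical all_reals all_analysis.
From mathcomp Require Import measurable_realfun ring lra.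

Set Implicit Arguments.
Unset Strict Implicit.
Unset Printing Implicit Defensive.

Import Order.TTheory GRing.Theory Num.Theory.
Import numFieldNormedType.Exports.

Local Open Scope classical_set_scope.
Local Open Scope ring_scope.

(* Both schemes are diagonal in the sine basis.  With mu = lambda_i^4, tau the
   time step and t = m tau, the i-th coefficient of U^m - uhat(t) is the integral
   over [0,t) of kappa_i times the i-th coefficient of the load, where kappa_i
   is the Crank-Nicolson propagator (piecewise constant, b r^j) minus
   exp(-mu (t - s)).  The load averages white noise over the cells T_n, so by
   Bessel's inequality for the normalized indicators of these cells the mean
   square of that coefficient is at most the integral of kappa_i^2.  The latter is
   O(tau min(x, 1/x)) with x = mu tau: for x <= 1 by comparing b r^j with the
   exponential step by step, for x >= 1 by summing both squares separately.
   As x = (i pi tau^(1/4))^4, summing over i gives O(tau^(3/4)), that is, the rate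
   tau^(3/8) even without the loss eps.

   The pathwise diagonalization rests on two facts about the weak formulation.
   The sines are complete on (0,1).  If moreover sum_k lambda_k^8 g_k^2 is finite and h is the
   weak fourth derivative of g, then h_k = lambda_k^4 g_k: test against
   smooth cutoffs of vareps k and pass to the limit in the sine series. *)

(** * Real-valued integrals *)

(** High modes are the obstacle: as [x] grows, the Crank-Nicolson ratio r tends to -1, so such a
    mode is hardly damped from one step to the next. The gain b compensates: since 1 - r^2 = 2 x
    b^2, the sum of the b^2 r^(2j) is at most 1/(2x), the same order as the mean square of the
    exponential. For small [x] the one-step propagators differ by at most x^2, the error after j
    steps is of order j q^j x^2 with q = 1/(1+x), a power of q absorbs the factor j, and the
    remaining geometric sum costs only 1/x.

    The two regimes are merged into the weaker bound 1/(1+y)^2 with x = y^4, because this form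
    telescopes over y = i pi tau^(1/4) to a bound that does not see the number of modes; Bessel's
    inequality likewise removes the length of the noise cells.

    In the weak formulation no estimate of the fourth derivatives of the cutoffs is attempted. The
    derivatives are moved onto the coefficients lambda_j^4 g_j, which are square summable, so that
    convergence of the cutoffs in L^2 is enough. *)

Section Rintegral_complements.
Context d (T : measurableType d) (R : realType).
Variable mu : {measure set T -> \bar R}.
Implicit Types (D : set T) (f g h : T -> R).

Lemma integrable_measurable_fun D f :
  mu.-integrable D (EFin \o f) -> measurable_fun D f.
Proof. by move=> /measurable_int /measurable_EFinP. Qed.

Lemma eq_integrableR D f g : measurable D -> (forall x, D x -> f x = g x) ->
  mu.-integrable D (EFin \o f) -> mu.-integrable D (EFin \o g).
Proof.
by move=> mD fg; apply: eq_integrable => // x; rewrite inE => Dx /=; rewrite fg.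
Qed.

Lemma integrable_le D f g : measurable D -> measurable_fun D f ->
  mu.-integrable D (EFin \o g) -> (forall x, D x -> `|f x| <= g x) ->
  mu.-integrable D (EFin \o f).
Proof.
move=> mD mf ig fg; apply: le_integrable ig => //; first exact/measurable_EFinP.
by move=> x Dx /=; rewrite lee_fin (le_trans (fg _ Dx))// ler_norm.
Qed.

Lemma integrable_bounded_fun D f (c : R) : measurable D -> (mu D < +oo)%E ->
  measurable_fun D f -> (forall x, D x -> `|f x| <= c) ->
  mu.-integrable D (EFin \o f).
Proof.
move=> mD Doo mf fc; apply: measurable_bounded_integrable => //.
exists c; split; first exact: num_real.
by move=> y cy x Dx /=; rewrite (le_trans (fc _ Dx))// ltW.
Qed.

Lemma integrable_mul_bounded D f g (c : R) : measurable D ->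
  mu.-integrable D (EFin \o f) -> measurable_fun D g ->
  (forall x, D x -> `|g x| <= c) -> mu.-integrable D (EFin \o (f \* g)).
Proof.
move=> mD iF mg gc.
apply: (@integrable_le _ _ (fun x => c * `|f x|)) => //.
- by apply: measurable_funM => //; exact: integrable_measurable_fun iF.
- by have := integrable_norm iF; move/(integrableZl mD c); apply: eq_integrable.
- by move=> x Dx /=; rewrite normrM mulrC ler_wpM2r// gc.
Qed.

Lemma integrableRD D f g : measurable D -> mu.-integrable D (EFin \o f) ->
  mu.-integrable D (EFin \o g) -> mu.-integrable D (EFin \o (fun x => f x + g x)).
Proof. by move=> mD iF ig; apply: eq_integrable (integrableD mD iF ig). Qed.

Lemma integrableRB D f g : measurable D -> mu.-integrable D (EFin \o f) ->
  mu.-integrable D (EFin \o g) -> mu.-integrable D (EFin \o (fun x => f x - g x)).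
Proof. by move=> mD iF ig; apply: eq_integrable (integrableB mD iF ig). Qed.

Lemma integrableRZ D (c : R) f : measurable D -> mu.-integrable D (EFin \o f) ->
  mu.-integrable D (EFin \o (fun x => c * f x)).
Proof. by move=> mD iF; apply: eq_integrable (integrableZl mD c iF). Qed.

Lemma integrableR_sum D I (s : seq I) (f : I -> T -> R) : measurable D ->
  (forall i, mu.-integrable D (EFin \o f i)) ->
  mu.-integrable D (EFin \o (fun x => \sum_(i <- s) f i x)).
Proof.
move=> mD iF; have := @integrable_sum _ _ _ mu _ mD _ s xpredT
  (fun i => EFin \o f i) (fun i _ => iF i).
by apply: eq_integrable => // x _ /=; rewrite sumEFin.
Qed.

Lemma Rintegral_sum D I (s : seq I) (f : I -> T -> R) : measurable D ->
  (forall i, mu.-integrable D (EFin \o f i)) ->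
  \int[mu]_(x in D) (\sum_(i <- s) f i x) = \sum_(i <- s) \int[mu]_(x in D) f i x.
Proof.
move=> mD iF; elim: s => [|i s IH].
  rewrite big_nil (@eq_Rintegral _ _ _ mu D (fun=> 0)) ?Rintegral_cst ?mul0r//.
  by move=> x _; rewrite big_nil.
rewrite big_cons -IH -RintegralD//; last exact: integrableR_sum.
by apply: eq_Rintegral => x _; rewrite big_cons.
Qed.

Lemma Rintegral_dominated D (f_ : nat -> T -> R) f g : measurable D ->
  (forall n, measurable_fun D (f_ n)) -> measurable_fun D f ->
  mu.-integrable D (EFin \o g) ->
  (forall x, D x -> f_ n x @[n --> \oo] --> f x) ->
  (forall n x, D x -> `|f_ n x| <= g x) ->
  (\int[mu]_(x in D) f_ n x) @[n --> \oo] --> \int[mu]_(x in D) f x.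
Proof.
move=> mD mf_ mf ig f_f f_g.
have [||||iF _ H] := @dominated_convergence _ _ _ mu _ mD (fun n => EFin \o f_ n)
  (EFin \o f) (EFin \o g) _ _ _ ig.
- by move=> n; exact/measurable_EFinP.
- exact/measurable_EFinP.
- by apply: aeW => x Dx; apply: cvg_EFin; [exact: nearW|exact: f_f].
- by apply: aeW => x Dx n; rewrite /= lee_fin; exact: f_g.
apply: fine_cvg; rewrite fineK ?integrable_fin_num//; exact: H.
Qed.

Lemma ae_eq_Rintegral D f g : measurable D ->
  measurable_fun D f -> measurable_fun D g ->
  {ae mu, forall x, D x -> f x = g x} ->
  \int[mu]_(x in D) f x = \int[mu]_(x in D) g x.
Proof.
move=> mD mf mg fg; congr fine; apply: ae_eq_integral => //.
- exact/measurable_EFinP.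
- exact/measurable_EFinP.
- by apply: filterS fg => x /= H Dx; rewrite H.
Qed.

End Rintegral_complements.

(** * Polynomials converging to a step function *)

Section power_sequences.
Variable R : realType.
Implicit Types (x z q : R) (n : nat).

Lemma bernoulli_inequality x n : -1 <= x -> 1 + n%:R * x <= (1 + x) ^+ n.
Proof.
move=> x1; elim: n => [|n IH]; first by rewrite mul0r addr0 expr0.
rewrite exprS (le_trans _ (ler_wpM2l _ IH))//; last by lra.
rewrite -natr1.
have : 0 <= n%:R * x ^+ 2 by rewrite mulr_ge0// sqr_ge0.
by nra.
Qed.

(** Half of the decay is spent on the factor n: with w the square root of z, n z^n = (n w^n) w^n,
    and n w^n is bounded since n w^n <= 1 + w + ... + w^(n-1). *)
Lemma cvg_natr_mul_expr z : 0 <= z < 1 -> n%:R * z ^+ n @[n --> \oo] --> (0 : R).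
Proof.
move=> /andP[z0 z1]; set w := Num.sqrt z.
have w0 : 0 <= w by exact: sqrtr_ge0.
have w1 : w < 1 by rewrite -[ltRHS]sqrtr1 ltr_sqrt.
have wb n : n%:R * w ^+ n <= (1 - w)^-1.
  rewrite -[leRHS]mul1r ler_pdivlMr ?subr_gt0//.
  suff : n%:R * w ^+ n * (1 - w) <= 1 - w ^+ n.
    by move=> /le_trans; apply; rewrite gerBl exprn_ge0.
  elim: n => [|n IH]; first by rewrite !mul0r subrr.
  have := ler_wpM2l w0 IH.
  have : w ^+ n.+1 <= 1 by rewrite exprn_ile1// ltW.
  rewrite -natr1 exprS; nra.
apply: (@squeeze_cvgr _ _ _ _ (cst 0) (geometric (1 - w)^-1 w)).
- near=> n; rewrite mulr_ge0 ?exprn_ge0//= -[z]sqr_sqrtr// -/w.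
  by rewrite -exprM mulnC exprM expr2 mulrA ler_wpM2r// exprn_ge0.
- exact: cvg_cst.
- by apply: cvg_geometric; rewrite ger0_norm.
Unshelve. all: by end_near. Qed.

(** A variant of the polynomials of elementary proofs of Stone-Weierstrass. The outer exponent times
    q^n equals n (2q)^n, which tends to 0 for q < 1/2 and is at least n for q >= 1/2; the factor n
    is what settles q = 1/2. *)
Definition step_poly n q := (1 - q ^+ n) ^+ (n * 2 ^ n).

Lemma step_poly_le n q : 0 <= q <= 1 -> 0 <= step_poly n q <= 1.
Proof.
move=> /andP[q0 q1].
have a0 : 0 <= q ^+ n by exact: exprn_ge0.
have a1 : q ^+ n <= 1 by exact: exprn_ile1.
by rewrite exprn_ge0 ?exprn_ile1//; lra.
Qed.

Lemma cvg_step_poly q : 0 <= q <= 1 ->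
  step_poly n q @[n --> \oo] --> ((q < 2^-1)%R%:R : R).
Proof.
move=> q01; have /andP[q0 q1] := q01.
have a0 n : 0 <= q ^+ n by exact: exprn_ge0.
have a1 n : q ^+ n <= 1 by exact: exprn_ile1.
have e n : (n * 2 ^ n)%:R * q ^+ n = n%:R * (2 * q) ^+ n :> R.
  by rewrite natrM natrX exprMn mulrA.
case: ltP => qh.
- have z01 : 0 <= 2 * q < 1 by apply/andP; split; lra.
  apply: (@squeeze_cvgr _ _ _ _ (fun n => 1 - n%:R * (2 * q) ^+ n) (cst 1)).
  + near=> n; have /andP[_ ->] := step_poly_le n q01; rewrite andbT.
    have := @bernoulli_inequality (- q ^+ n) (n * 2 ^ n); rewrite mulrN e.
    by apply; rewrite lerN2.
  + rewrite -[X in _ --> X]subr0; apply: cvgB; first exact: cvg_cst.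
    exact: cvg_natr_mul_expr.
  + exact: cvg_cst.
- apply: (@squeeze_cvgr _ _ _ _ (cst 0) (@harmonic R)).
  + near=> n; have /andP[-> _] := step_poly_le n q01 => /=.
    rewrite -[leRHS]mul1r ler_pdivlMr//.
    (* An upper bound on (1 - a)^K comes from (1 - a)(1 + a) <= 1 and Bernoulli for 1 + a: it is at
       most 1/(1 + K a) <= 1/(1 + n). *)
    have t1 : (1 - q ^+ n) ^+ (n * 2 ^ n) * (1 + q ^+ n) ^+ (n * 2 ^ n) <= 1.
      rewrite -exprMn exprn_ile1//; have := a0 n; have := a1 n; nra.
    apply: le_trans t1; rewrite ler_wpM2l//.
      by have /andP[] := step_poly_le n q01.
    have := @bernoulli_inequality (q ^+ n) (n * 2 ^ n); rewrite e.
    move=> H; apply: le_trans (H _); last by have := a0 n; lra.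
    rewrite -natr1 addrC lerD2l ler_peMr// exprn_ege1//; lra.
  + exact: cvg_cst.
  + exact: cvg_harmonic.
Unshelve. all: by end_near. Qed.

End power_sequences.

(** * Completeness of the sine system *)

Section sine_completeness.
Variable R : realType.
Notation mu := (@lebesgue_measure R).
Implicit Types f g h : R -> R.

Lemma lebesgue_measure_dom : mu (dom R) = 1%:E.
Proof. by rewrite /dom lebesgue_measure_itv/= lte_fin ltr01 sube0. Qed.

Lemma measurable_dom : measurable (dom R).
Proof. exact: measurable_itv. Qed.

Lemma continuous_measurable_dom f (D : set R) :
  continuous f -> measurable_fun D f.
Proof.
by move=> cf; apply: measurable_funTS; exact: continuous_measurable_fun.
Qed.

Lemma continuous_sinM (c : R) : continuous (fun x => sin (c * x)).
Proof.
move=> x; apply: (@continuous_comp _ _ _ (fun x => c * x) (@sin R)).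
  exact: mulrl_continuous.
exact: continuous_sin.
Qed.

Lemma continuous_cosM (c : R) : continuous (fun x => cos (c * x)).
Proof.
move=> x; apply: (@continuous_comp _ _ _ (fun x => c * x) (@cos R)).
  exact: mulrl_continuous.
exact: continuous_cos.
Qed.

Definition sine_orthogonal g f := [/\ measurable_fun (dom R) f,
  exists c : R, forall x, dom R x -> `|f x| <= c &
  forall k : nat, \int[mu]_(x in dom R) (g x * (sin (lambda R k * x) * f x)) = 0].

Section orthogonal.
Variables (g : R -> R) (ig : mu.-integrable (dom R) (EFin \o g)).

Lemma sine_orthogonal_integrable f k : measurable_fun (dom R) f ->
    (exists c : R, forall x, dom R x -> `|f x| <= c) ->
  mu.-integrable (dom R) (EFin \o (fun x => g x * (sin (lambda R k * x) * f x))).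
Proof.
move=> mf [c fc]; have mD := measurable_dom.
apply: (@integrable_mul_bounded _ _ _ mu (dom R) g
  (fun x => sin (lambda R k * x) * f x) c) => //.
  by apply: measurable_funM => //; apply: continuous_measurable_dom; exact: continuous_sinM.
move=> x Dx; rewrite normrM -[leRHS]mul1r ler_pM//; first exact: sin_max.
exact: fc.
Qed.

Lemma sine_orthogonal_lin (a b : R) f h :
  sine_orthogonal g f -> sine_orthogonal g h ->
  sine_orthogonal g (fun x => a * f x + b * h x).
Proof.
move=> [mf bf of_] [mh bh oh]; have mD := measurable_dom; split.
- by apply: measurable_funD; apply: measurable_funM.
- case: bf => c fc; case: bh => e he; exists (`|a| * c + `|b| * e) => x Dx.
  rewrite (le_trans (ler_normD _ _))// !normrM lerD// ler_wpM2l//.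
    exact: fc.
  exact: he.
- move=> k.
  transitivity (\int[mu]_(x in dom R) (a * (g x * (sin (lambda R k * x) * f x)) +
    b * (g x * (sin (lambda R k * x) * h x)))).
    by apply: eq_Rintegral => x _; ring.
  rewrite RintegralD//; try by apply: integrableRZ => //; exact: sine_orthogonal_integrable.
  rewrite !RintegralZl ?of_ ?oh ?mulr0 ?addr0//.
  - exact: sine_orthogonal_integrable.
  - exact: sine_orthogonal_integrable.
Qed.

Lemma lambdaS k : lambda R k.+1 = lambda R k + pi.
Proof. by rewrite /lambda -natr1 mulrDl mul1r. Qed.

(** By 2 sin(k pi x) cos(pi x) = sin((k+1) pi x) + sin((k-1) pi x), orthogonality to all sines
    survives the factor cos(pi x). Admitting k = 0 in [sine_orthogonal], where the sine vanishes,
    makes the term k - 1 harmless at k = 1. *)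
Lemma sine_orthogonal_cos f :
  sine_orthogonal g f -> sine_orthogonal g (fun x => cos (pi * x) * f x).
Proof.
move=> [mf bf of_]; have mD := measurable_dom; split.
- by apply: measurable_funM => //; apply: continuous_measurable_dom; exact: continuous_cosM.
- case: bf => c fc; exists c => x Dx.
  by rewrite normrM -[leRHS]mul1r ler_pM ?cos_max ?fc.
- case=> [|k].
    under eq_Rintegral do rewrite /lambda mul0r mul0r sin0 mul0r mulr0.
    by rewrite Rintegral_cst ?mul0r//; exact: measurable_dom.
  transitivity (\int[mu]_(x in dom R)
    (2^-1 * (g x * (sin (lambda R k.+2 * x) * f x)) +
     2^-1 * (g x * (sin (lambda R k * x) * f x)))).
    apply: eq_Rintegral => x _.
    have -> : lambda R k.+2 * x = lambda R k.+1 * x + pi * x.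
      by rewrite lambdaS; ring.
    have -> : lambda R k * x = lambda R k.+1 * x - pi * x.
      by rewrite lambdaS; ring.
    by rewrite sinD sinB; field.
  rewrite RintegralD//; try by apply: integrableRZ => //; exact: sine_orthogonal_integrable.
  rewrite !RintegralZl ?of_ ?mulr0 ?addr0//.
  - exact: sine_orthogonal_integrable.
  - exact: sine_orthogonal_integrable.
Qed.

Variables a b : R.
Let q x : R := a + b * cos (pi * x).

Lemma sine_orthogonal_expr f n :
  sine_orthogonal g f -> sine_orthogonal g (fun x => q x ^+ n * f x).
Proof.
move=> of_; elim: n => [|n IH]; first by under eq_fun do rewrite expr0 mul1r.
have := sine_orthogonal_lin a b IH (sine_orthogonal_cos IH).
by congr sine_orthogonal; apply/funext => x; rewrite exprS /q; ring.
Qed.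

Lemma sine_orthogonal_onem_expr f n m :
  sine_orthogonal g f -> sine_orthogonal g (fun x => (1 - q x ^+ n) ^+ m * f x).
Proof.
move=> of_; elim: m => [|m IH]; first by under eq_fun do rewrite expr0 mul1r.
have := sine_orthogonal_lin 1 (-1) IH (sine_orthogonal_expr n IH).
by congr sine_orthogonal; apply/funext => x; rewrite exprS /q; ring.
Qed.

End orthogonal.

Variables (g : R -> R) (ig : mu.-integrable (dom R) (EFin \o g)).
Hypothesis g_sin : forall k, (1 <= k)%N ->
  \int[mu]_(x in dom R) (g x * sin (lambda R k * x)) = 0.

Lemma sine_orthogonal1 : sine_orthogonal g (fun=> 1).
Proof.
split; first exact: measurable_cst.
  by exists 1 => x _; rewrite normr1.
case=> [|k].
  under eq_Rintegral do rewrite /lambda mul0r mul0r sin0 mul0r mulr0.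
  by rewrite Rintegral_cst ?mul0r//; exact: measurable_dom.
under eq_Rintegral do rewrite mulr1.
exact: g_sin.
Qed.

(* On (0,1) the polynomials (1 - q^n)^(n 2^n) in cos (pi x) tend to the
   indicator of (0,a), where q is affine in cos (pi x) and equals 1/2 at a. *)
Lemma sine_orthogonal_indic (a : R) : 0 < a < 1 ->
  \int[mu]_(x in dom R) (g x * (sin (lambda R 1 * x) * (x < a)%R%:R)) = 0.
Proof.
move=> /andP[a0 a1]; have mD := measurable_dom.
(* The factor 1/4 keeps q within [0,1]; since cos decreases on [0,pi], q x < 1/2 means x < a on
   (0,1). *)
pose q x : R := (2^-1 + 4^-1 * cos (pi * a)) + (- 4^-1) * cos (pi * x).
have q01 x : 0 <= q x <= 1.
  have := cos_geN1 (pi * a); have := cos_le1 (pi * a).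
  have := cos_geN1 (pi * x); have := cos_le1 (pi * x).
  by move=> *; rewrite /q; apply/andP; split; lra.
have qE x : dom R x -> (q x < 2^-1)%R = (x < a)%R.
  rewrite /dom/= in_itv/= => /andP[x0 x1].
  have pi0 := pi_gt0 R.
  rewrite -[RHS](ltr_pM2l pi0) -[RHS]ltr_cos.
  - by rewrite /q; apply/idP/idP => ?; lra.
  - by rewrite in_itv/=; apply/andP; split; [rewrite mulr_ge0 ?ltW|rewrite ler_piMr ?ltW].
  - by rewrite in_itv/=; apply/andP; split; [rewrite mulr_ge0 ?ltW|rewrite ler_piMr ?ltW].
have mg := integrable_measurable_fun ig.
have mq n : measurable_fun (dom R) (fun x => step_poly n (q x)).
  apply/measurable_funX/measurable_funB => //; apply/measurable_funX.
  apply: measurable_funD => //; apply: measurable_funM => //.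
  apply: continuous_measurable_dom; exact: continuous_cosM.
have ms : measurable_fun (dom R) (fun x => sin (lambda R 1 * x)).
  apply: continuous_measurable_dom; exact: continuous_sinM.
have H : \int[mu]_(x in dom R) (g x * (sin (lambda R 1 * x) * step_poly n (q x)))
    @[n --> \oo] -->
    \int[mu]_(x in dom R) (g x * (sin (lambda R 1 * x) * (x < a)%R%:R)).
  apply: (@Rintegral_dominated _ _ _ mu _ _ _ (fun x => `|g x|)) => //.
  - move=> n; apply: measurable_funM => //; apply: measurable_funM => //; exact: mq.
  - apply: measurable_funM => //; apply: measurable_funM => //.
    rewrite (_ : (fun x : R => (x < a)%R%:R) = \1_`]-oo, a[).
      exact: measurable_indic.
    by apply/funext => x; rewrite indicE mem_setE in_itv.
  - exact: integrable_norm ig.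
  - move=> x Dx; apply: cvgM; first exact: cvg_cst.
    apply: cvgM; first exact: cvg_cst.
    by rewrite -qE//; exact: cvg_step_poly.
  - move=> n x Dx; rewrite normrM ler_piMr// normrM -[leRHS]mulr1.
    have /andP[s0 s1] := step_poly_le n (q01 x).
    by rewrite ler_pM ?sin_max// ger0_norm.
have E n : \int[mu]_(x in dom R) (g x * (sin (lambda R 1 * x) * step_poly n (q x))) = 0.
  have [_ _ /(_ 1%N)] := sine_orthogonal_onem_expr ig
    (2^-1 + 4^-1 * cos (pi * a)) (- 4^-1) n (n * 2 ^ n) sine_orthogonal1.
  by under eq_Rintegral do rewrite mulr1.
apply/esym; apply: (cvg_unique _ _ H); first exact: Rhausdorff.
rewrite (_ : (fun n => _) = cst 0); first exact: cvg_cst.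
by apply/funext => n; exact: E.
Qed.

(** All primitives of g(x) sin(pi x) from the left end vanish, so Lebesgue differentiation makes
    this product zero almost everywhere, and sin(pi x) is positive on (0,1). *)
Lemma sine_complete : {ae mu, forall x, dom R x -> g x = 0}.
Proof.
have mD := measurable_dom.
pose w x := sin (lambda R 1 * x).
have iw : mu.-integrable (dom R) (EFin \o (g \* w)).
  apply: (@integrable_mul_bounded _ _ _ mu (dom R) g w 1) => //.
    by apply: continuous_measurable_dom; exact: continuous_sinM.
  by move=> x _; exact: sin_max.
pose f := (g \* w) \_ (dom R).
have iF : mu.-integrable setT (EFin \o f).
  by rewrite /f -restrict_EFin; apply/integrable_restrict => //; rewrite setTI.
have F0 y : \int[mu]_(t in `]-oo, y]) f t = 0.
  rewrite -Rintegral_itv_bndo_bndc; last first.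
    by apply: integrableS iF => //.
  rewrite Rintegral_mkcond (_ : f \_ _ = (fun t => (g t * (w t * (t < y)%R%:R))) \_ (dom R)).
    rewrite -Rintegral_mkcond.
    have [y0|y0] := leP y 0.
      rewrite (@eq_Rintegral _ _ _ mu (dom R) (fun=> 0)) ?Rintegral_cst ?mul0r//.
      move=> t; rewrite inE /dom/= in_itv/= => /andP[t0 t1].
      by rewrite ltNge (le_trans y0 (ltW t0))/= !mulr0.
    have [y1|y1] := leP 1 y.
      rewrite -[RHS](@g_sin 1)//; apply: eq_Rintegral.
      move=> t; rewrite inE /dom/= in_itv/= => /andP[t0 t1].
      by rewrite (lt_le_trans t1 y1) mulr1.
    by apply: sine_orthogonal_indic; rewrite y0.
  apply/funext => t; rewrite /f !patchE mem_setE in_itv/=.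
  by case: ltP => ty; case: ifP => // _; rewrite ?mulr1 ?mulr0.
have iNy y : mu.-integrable `]-oo, y] (EFin \o f) by apply: integrableS iF.
have := FTC1Ny iNy.
have lf : locally_integrable [set: R] f.
  apply: integrable_locally => //.
move=> /(_ lf); apply: filterS; first exact: (ae_filter_ringOfSetsType mu).
move=> x [_ +] Dx.
rewrite (_ : (fun y => _) = cst 0); last by apply/funext => y; exact: F0.
rewrite derive1_cst /f patchE mem_set// => /esym/eqP; rewrite mulf_eq0 => /orP[/eqP//|].
move: Dx; rewrite /dom/= in_itv/= => /andP[x0 x1].
rewrite /w /lambda mul1r gt_eqF// sin_gt0_pi// mulr_gt0 ?pi_gt0//=.
by rewrite gtr_pMr ?pi_gt0.
Qed.

End sine_completeness.

(** * Square-integrable functions on (0,1) *)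

Section FTC_open_interval.
Variable R : realType.
Notation mu := (@lebesgue_measure R).

Lemma continuous_integrable_oo (f : R -> R) (a b : R) : continuous f ->
  mu.-integrable `]a, b[ (EFin \o f).
Proof.
move=> cf; apply: (@integrableS _ _ _ mu `[a, b]) => //.
  exact: subset_itv_oo_cc.
apply: continuous_compact_integrable; first exact: segment_compact.
exact: continuous_subspaceT.
Qed.

Lemma Rintegral_FTC (f F : R -> R) (a b : R) : a < b -> continuous f ->
  (forall x : R, is_derive x 1 F (f x)) ->
  \int[mu]_(x in `]a, b[) f x = F b - F a.
Proof.
move=> ab cf dF.
have df (x : R) : derivable F x 1 by case: (dF x).
have cF : continuous F.
  by move=> x; apply/differentiable_continuous/derivable1_diffP.
have icc : mu.-integrable `[a, b] (EFin \o f).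
  apply: continuous_compact_integrable; first exact: segment_compact.
  exact: continuous_subspaceT.
rewrite Rintegral_itv_obnd_cbnd; last exact: continuous_integrable_oo.
rewrite Rintegral_itv_bndo_bndc; last first.
  by apply: integrableS icc => //; exact: subset_itv_co_cc.
rewrite /Rintegral (@continuous_FTC2 R f F)//.
- exact: continuous_subspaceT.
- split => // [|].
  + exact/cvg_at_right_filter/cF.
  + exact/cvg_at_left_filter/cF.
- by move=> x _; rewrite derive1E; case: (dF x).
Qed.

End FTC_open_interval.

Section L2_dom.
Variable R : realType.
Notation mu := (@lebesgue_measure R).
Implicit Types f g h : R -> R.

Lemma inL2_measurable f : inL2 f -> measurable_fun (dom R) f.
Proof. by case. Qed.

Lemma inL2_sqr_integrable f : inL2 f ->
  mu.-integrable (dom R) (EFin \o (fun x => f x ^+ 2)).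
Proof.
move=> [mf foo]; apply/integrableP; split.
  by apply/measurable_EFinP; exact: measurable_funX.
by under eq_integral do rewrite /= ger0_norm ?sqr_ge0//.
Qed.

Lemma sqr_integrable_inL2 f : measurable_fun (dom R) f ->
  mu.-integrable (dom R) (EFin \o (fun x => f x ^+ 2)) -> inL2 f.
Proof.
move=> mf iF; split => //.
by apply: integrable_lty iF; exact: measurable_dom.
Qed.

Lemma inL2_mul_integrable f g : inL2 f -> inL2 g ->
  mu.-integrable (dom R) (EFin \o (fun x => f x * g x)).
Proof.
move=> hf hg; have mD := @measurable_dom R.
apply: (@integrable_le _ _ _ mu _ _ (fun x => f x ^+ 2 + g x ^+ 2)) => //.
- by apply: measurable_funM; exact: inL2_measurable.
- by apply: integrableRD => //; exact: inL2_sqr_integrable.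
- move=> x _; rewrite ler_norml; apply/andP; split.
    by have := sqr_ge0 (f x + g x); have := sqr_ge0 (f x); have := sqr_ge0 (g x); nra.
  by have := sqr_ge0 (f x - g x); have := sqr_ge0 (f x); have := sqr_ge0 (g x); nra.
Qed.

Lemma bounded_inL2 f (c : R) : measurable_fun (dom R) f ->
  (forall x, dom R x -> `|f x| <= c) -> inL2 f.
Proof.
move=> mf fc; have mD := @measurable_dom R.
apply: sqr_integrable_inL2 => //.
apply: (@integrable_bounded_fun _ _ _ mu _ _ (c ^+ 2)) => //.
- by rewrite [X in (X < _)%E]lebesgue_measure_dom ltry.
- exact: measurable_funX.
- move=> x Dx; rewrite normrX lerXn2r// ?nnegrE//; last exact: fc.
  by rewrite (le_trans _ (fc _ Dx)).
Qed.

Lemma inL2_integrable f : inL2 f -> mu.-integrable (dom R) (EFin \o f).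
Proof.
move=> hf; have h1 : inL2 (cst 1 : R -> R).
  by apply: (@bounded_inL2 _ 1) => // x _; rewrite normr1.
apply: eq_integrableR (inL2_mul_integrable hf h1); first exact: measurable_dom.
by move=> x _ /=; rewrite mulr1.
Qed.

Lemma inL2D f g : inL2 f -> inL2 g -> inL2 (fun x => f x + g x).
Proof.
move=> hf hg; have mD := @measurable_dom R; apply: sqr_integrable_inL2.
  by apply: measurable_funD; exact: inL2_measurable.
apply: (@integrable_le _ _ _ mu _ _ (fun x => 2 * (f x ^+ 2 + g x ^+ 2))) => //.
- by apply/measurable_funX/measurable_funD; exact: inL2_measurable.
- by apply/integrableRZ/integrableRD => //; exact: inL2_sqr_integrable.
- by move=> x _; rewrite ger0_norm ?sqr_ge0//; have := sqr_ge0 (f x - g x); nra.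
Qed.

Lemma inL2Z (c : R) f : inL2 f -> inL2 (fun x => c * f x).
Proof.
move=> hf; have mD := @measurable_dom R; apply: sqr_integrable_inL2.
  by apply: measurable_funM => //; exact: inL2_measurable.
apply: eq_integrableR (integrableRZ (c ^+ 2) _ (inL2_sqr_integrable hf)) => //.
by move=> x _ /=; rewrite exprMn.
Qed.

Lemma inL2B f g : inL2 f -> inL2 g -> inL2 (fun x => f x - g x).
Proof.
move=> hf /(@inL2Z (-1)) hg; have := inL2D hf hg.
by under eq_fun do rewrite mulN1r.
Qed.

Lemma inL2_0 : inL2 (fun _ : R => 0 : R).
Proof. by apply: (@bounded_inL2 _ 0) => // x _; rewrite normr0. Qed.

Lemma inL2_sum I (s : seq I) (f : I -> R -> R) : (forall i, inL2 (f i)) ->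
  inL2 (fun x => \sum_(i <- s) f i x).
Proof.
move=> hf; elim: s => [|i s IH].
  by under eq_fun do rewrite big_nil; exact: inL2_0.
by under eq_fun do rewrite big_cons; exact: inL2D.
Qed.

Lemma L2_innerC f g : L2_inner f g = L2_inner g f.
Proof. by apply: eq_Rintegral => x _; rewrite mulrC. Qed.

Lemma L2_innerDl f g h : inL2 f -> inL2 g -> inL2 h ->
  L2_inner (fun x => f x + g x) h = L2_inner f h + L2_inner g h.
Proof.
move=> hf hg hh; have mD := @measurable_dom R; rewrite /L2_inner -RintegralD//.
- by apply: eq_Rintegral => x _; rewrite mulrDl.
- exact: inL2_mul_integrable.
- exact: inL2_mul_integrable.
Qed.

Lemma L2_innerZl (c : R) f h : inL2 f -> inL2 h ->
  L2_inner (fun x => c * f x) h = c * L2_inner f h.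
Proof.
move=> hf hh; have mD := @measurable_dom R; rewrite /L2_inner -RintegralZl//.
  by apply: eq_Rintegral => x _; rewrite mulrA.
exact: inL2_mul_integrable.
Qed.

Lemma L2_innerBl f g h : inL2 f -> inL2 g -> inL2 h ->
  L2_inner (fun x => f x - g x) h = L2_inner f h - L2_inner g h.
Proof.
move=> hf hg hh; have mD := @measurable_dom R; rewrite /L2_inner -RintegralB//.
- by apply: eq_Rintegral => x _; rewrite mulrBl.
- exact: inL2_mul_integrable.
- exact: inL2_mul_integrable.
Qed.

Lemma L2_inner0l h : L2_inner (fun _ : R => 0) h = 0.
Proof.
rewrite /L2_inner (@eq_Rintegral _ _ _ _ _ (fun=> 0)) ?Rintegral_cst ?mul0r//.
  exact: measurable_dom.
by move=> x _; rewrite mul0r.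
Qed.

Lemma L2_inner_suml I (s : seq I) (f : I -> R -> R) h :
  (forall i, inL2 (f i)) -> inL2 h ->
  L2_inner (fun x => \sum_(i <- s) f i x) h = \sum_(i <- s) L2_inner (f i) h.
Proof.
move=> hf hh; have mD := @measurable_dom R; rewrite /L2_inner -Rintegral_sum//.
- by apply: eq_Rintegral => x _; rewrite mulr_suml.
- by move=> i; exact: inL2_mul_integrable.
Qed.

Lemma ae_eq_L2_inner f g h : inL2 f -> inL2 g -> inL2 h ->
  {ae mu, forall x, dom R x -> f x = g x} -> L2_inner f h = L2_inner g h.
Proof.
move=> hf hg hh fg; have mD := @measurable_dom R; apply: ae_eq_Rintegral => //.
- by apply: measurable_funM; exact: inL2_measurable.
- by apply: measurable_funM; exact: inL2_measurable.
- by apply: filterS fg; [exact: (ae_filter_ringOfSetsType mu)|move=> x + Dx => ->].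
Qed.

Lemma continuous_vareps k : continuous (@vareps R k).
Proof.
move=> x; apply: cvgM; first exact: cvg_cst.
exact: continuous_sinM.
Qed.

Lemma vareps_le2 k (x : R) : `|vareps k x| <= 2.
Proof.
have s2 : Num.sqrt 2 <= 2 :> R.
  have := sqr_sqrtr (ler0n R 2); have := sqrtr_ge0 (2 : R); nra.
by rewrite normrM -[leRHS]mulr1 ler_pM ?sin_max// ger0_norm// sqrtr_ge0.
Qed.

Lemma inL2_vareps k : inL2 (@vareps R k).
Proof.
apply: (@bounded_inL2 _ 2); last by move=> x _; exact: vareps_le2.
by apply: continuous_measurable_dom; exact: continuous_vareps.
Qed.

Lemma is_derive_sinM (c x : R) :
  is_derive x 1 (fun y => sin (c * y)) (c * cos (c * x)).
Proof. by apply: is_derive_eq; rewrite !scaler1 mulrC. Qed.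

Lemma is_derive_cosM (c x : R) :
  is_derive x 1 (fun y => cos (c * y)) (- (c * sin (c * x))).
Proof. by apply: is_derive_eq; rewrite !scaler1 mulNr mulrC. Qed.

Lemma sin_natpi k : sin (k%:R * pi) = 0 :> R.
Proof.
elim: k => [|k IH]; first by rewrite mul0r sin0.
by rewrite -natr1 mulrDl mul1r sinDpi IH oppr0.
Qed.

Lemma Rintegral_cos_natpi k : (0 < k)%N ->
  \int[mu]_(x in dom R) cos (lambda R k * x) = 0.
Proof.
move=> k0; have l0 : lambda R k != 0.
  by rewrite mulf_neq0 ?pnatr_eq0 ?gt_eqF ?pi_gt0// -lt0n.
have dF (x : R) : is_derive x 1 (fun x => (lambda R k)^-1 * sin (lambda R k * x))
    (cos (lambda R k * x)).
  by apply: is_derive_eq; rewrite !scaler1 /GRing.scale/= mulrC mulfK.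
rewrite (Rintegral_FTC ltr01 (@continuous_cosM _ _) dF).
by rewrite mulr0 sin0 mulr0 mulr1 sin_natpi mulr0 subrr.
Qed.

Lemma L2_inner_vareps j k : (0 < j)%N -> (0 < k)%N ->
  L2_inner (@vareps R j) (vareps k) = (j == k)%:R.
Proof.
have mD := @measurable_dom R.
have ic m : mu.-integrable (dom R) (EFin \o (fun x => cos (lambda R m * x))).
  by apply: continuous_integrable_oo; exact: continuous_cosM.
wlog jk : j k / (j <= k)%N.
  move=> H; case: (leqP j k) => [|/ltnW kj j0 k0]; first exact: H.
  by rewrite L2_innerC H// eq_sym.
move=> j0 k0; transitivity (\int[mu]_(x in dom R)
  (cos (lambda R (k - j) * x) - cos (lambda R (j + k) * x))).
  apply: eq_Rintegral => x _.
  have -> : lambda R (k - j) * x = lambda R k * x - lambda R j * x.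
    by rewrite /lambda natrB//; ring.
  have -> : lambda R (j + k) * x = lambda R k * x + lambda R j * x.
    by rewrite /lambda natrD; ring.
  rewrite /vareps cosB cosD; have : Num.sqrt 2 ^+ 2 = 2 :> R by rewrite sqr_sqrtr.
  by set s := Num.sqrt 2 => s2; rewrite mulrACA -expr2 s2; ring.
rewrite RintegralB// (@Rintegral_cos_natpi (j + k)) ?addn_gt0 ?j0// subr0.
have [->|njk] := eqVneq j k.
  rewrite (@eq_Rintegral _ _ _ _ _ (fun=> 1)); last first.
    by move=> x _; rewrite subnn /lambda mul0r mul0r cos0.
  by rewrite Rintegral_cst// [X in fine X]lebesgue_measure_dom mulr1.
by rewrite Rintegral_cos_natpi// subn_gt0 ltn_neqAle njk.
Qed.

Lemma bessel f n : inL2 f ->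
  \sum_(1 <= j < n) L2_inner f (vareps j) ^+ 2 <= L2_inner f f.
Proof.
move=> hf; set c := fun j => L2_inner f (vareps j).
pose S := fun x => \sum_(1 <= j < n) c j * vareps j x.
have hc j : inL2 (fun x => c j * vareps j x) by exact/inL2Z/inL2_vareps.
have hS : inL2 S by exact: inL2_sum.
have SE k : (1 <= k < n)%N -> L2_inner S (vareps k) = c k.
  move=> /andP[k1 kn]; rewrite L2_inner_suml//; last exact: inL2_vareps.
  rewrite (bigD1_seq k)/= ?mem_index_iota ?k1 ?iota_uniq//.
  rewrite L2_innerZl; [|exact: inL2_vareps..].
  rewrite L2_inner_vareps// eqxx mulr1 big_nat_cond big1 ?addr0// => j.
  move=> /andP[/andP[j1 _] jk].
  by rewrite L2_innerZl ?L2_inner_vareps ?(negbTE jk) ?mulr0//; exact: inL2_vareps.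
have Sf : L2_inner S f = \sum_(1 <= j < n) c j ^+ 2.
  rewrite L2_inner_suml//; apply: eq_bigr => j _.
  by rewrite L2_innerZl//; [rewrite L2_innerC expr2|exact: inL2_vareps].
have SS : L2_inner S S = \sum_(1 <= j < n) c j ^+ 2.
  rewrite L2_inner_suml//; apply: eq_big_nat => j jn.
  rewrite L2_innerZl//; last exact: inL2_vareps.
  by rewrite L2_innerC SE// expr2.
have : 0 <= L2_inner (fun x => f x - S x) (fun x => f x - S x).
  by apply: Rintegral_ge0 => x _; rewrite -expr2 sqr_ge0.
have hfS : inL2 (fun x => f x - S x) by exact: inL2B.
rewrite L2_innerBl// !(L2_innerC _ (fun x => _ - _)) !L2_innerBl//.
by rewrite (L2_innerC f S) Sf SS subrr subr0 subr_ge0.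
Qed.

End L2_dom.

(** * Smooth cutoffs of the sine functions *)

Section smooth_functions.
Variable R : realType.
Implicit Types (f g : R -> R) (n : nat).

(** Differentiability up to a finite order, with the derivative taken on the inside: closure under
    sums, products and affine substitution then follows by induction on the order, once a first
    derivative is exhibited ([ndiffS]). *)
Fixpoint ndiff n f : Prop :=
  if n is n'.+1 then (forall x, derivable f (x : R) 1) /\ ndiff n' (derive1 f) else True.

Definition smooth f := forall n, ndiff n f.

Lemma derive1nSr n f : derive1n n.+1 f = derive1n n (derive1 f).
Proof. by rewrite /derive1n iterSr. Qed.

Lemma smooth_derivable f : smooth f -> forall n x, derivable (derive1n n f) x 1.
Proof.
move=> sf n; have := sf n.+1; elim: n f {sf} => [|n IH] f; first by case.
by move=> [_ /IH H] x; rewrite derive1nSr; exact: H.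
Qed.

Lemma ndiffW n f : ndiff n.+1 f -> ndiff n f.
Proof. by elim: n f => // n IH f [df /IH]. Qed.

Lemma ndiffS n f g : (forall x : R, is_derive x 1 f (g x)) -> ndiff n g ->
  ndiff n.+1 f.
Proof.
move=> df ng; split; first by move=> x; case: (df x).
rewrite (_ : (derive1 f) = g)//.
by apply/funext => x; rewrite derive1E; case: (df x).
Qed.

Lemma ndiff_is_derive n f (x : R) : ndiff n.+1 f -> is_derive x 1 f ((derive1 f) x).
Proof. by move=> [df _]; rewrite derive1E; exact: derivableP. Qed.

Lemma ndiffD n f g : ndiff n f -> ndiff n g -> ndiff n (fun x => f x + g x).
Proof.
elim: n f g => // n IH f g nf ng.
apply: (@ndiffS _ _ (fun x => (derive1 f) x + (derive1 g) x)).
  move=> x; have := ndiff_is_derive x nf; have := ndiff_is_derive x ng.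
  by move=> dg df; exact: is_deriveD.
by case: nf => _ nf; case: ng => _ ng; exact: IH.
Qed.

Lemma ndiffM n f g : ndiff n f -> ndiff n g -> ndiff n (fun x => f x * g x).
Proof.
elim: n f g => // n IH f g nf ng.
apply: (@ndiffS _ _ (fun x => f x * (derive1 g) x + g x * (derive1 f) x)).
  move=> x; have := ndiff_is_derive x nf; have := ndiff_is_derive x ng.
  by move=> dg df; exact: is_deriveM.
by apply: ndiffD; apply: IH; [exact: ndiffW nf|case: ng|exact: ndiffW ng|case: nf].
Qed.

Lemma ndiff_cst n (c : R) : ndiff n (fun=> c).
Proof.
elim: n c => // n IH c; by apply: (@ndiffS _ _ (fun=> 0)).
Qed.

Lemma ndiff_affine n f (c e : R) : ndiff n f -> ndiff n (fun x => f (c * x + e)).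
Proof.
elim: n f => // n IH f nf.
apply: (@ndiffS _ _ (fun x => (derive1 f) (c * x + e) * c)).
  move=> x; have df := ndiff_is_derive (c * x + e) nf.
  apply: (@is_derive1_comp R f (fun x => c * x + e)).
  by apply: is_derive_eq; rewrite scaler1 addr0.
by apply: ndiffM; [apply: IH; case: nf|exact: ndiff_cst].
Qed.

Lemma ndiff_trigo n (a b c : R) : ndiff n (fun x => a * sin (c * x) + b * cos (c * x)).
Proof.
elim: n a b => // n IH a b.
apply: (@ndiffS _ _ (fun x => (- (b * c)) * sin (c * x) + (a * c) * cos (c * x))).
  by move=> x; apply: is_derive_eq; rewrite /GRing.scale/=; ring.
exact: IH.
Qed.

(** Order n = 0 is the classical flat function exp(-1/x). The powers x^(-n) are included because
    differentiation stays within the linear span of this family, which gives smoothness by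
    induction. *)
Definition flat_exp n (x : R) : R := if 0 < x then x^-1 ^+ n * expR (- x^-1) else 0.

Lemma flat_exp_eq0 n (x : R) : x <= 0 -> flat_exp n x = 0.
Proof. by rewrite /flat_exp leNgt => /negbTE ->. Qed.

Lemma exprn_expRN_le n (y : R) : 0 <= y -> y ^+ n * expR (- y) <= n`!%:R.
Proof.
move=> y0; rewrite expRN ler_pdivrMr ?expR_gt0//.
case: n => [|n]; first by rewrite fact0 mul1r expr0 -expR0 ler_expR.
rewrite mulrC -ler_pdivrMr ?ltr0n ?fact_gt0//.
by apply: le_trans (expR_ge1Dxn n y0); rewrite lerDr.
Qed.

(** With y = 1/x this is y^(n+2) exp(-y) <= (n+2)!. Two powers of x make the difference quotient at
    0 tend to 0. *)
Lemma flat_exp_le n (x : R) : `|flat_exp n x| <= n.+2`!%:R * x ^+ 2.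
Proof.
rewrite /flat_exp; case: ifPn => [x0|_]; last first.
  by rewrite normr0 mulr_ge0// ?sqr_ge0.
have y0 : 0 <= x^-1 by rewrite invr_ge0 ltW.
rewrite ger0_norm; last by rewrite mulr_ge0 ?exprn_ge0 ?expR_ge0.
rewrite -ler_pdivrMr ?exprn_gt0// mulrAC -exprVn -exprD addn2.
exact: exprn_expRN_le.
Qed.

Lemma is_derive_flat_exp n (x : R) : is_derive x 1 (flat_exp n)
  (- n%:R * flat_exp n.+1 x + flat_exp n.+2 x).
Proof.
have [x0|x0|->] := ltgtP x 0.
- apply: (@near_eq_is_derive _ _ _ (cst 0)).
    by near=> z; rewrite /flat_exp ltNge ltW//; near: z; exact: lt_nbhsl.
  apply: is_derive_eq.
  by rewrite /flat_exp !ltNge (ltW x0)/= mulr0 addr0.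
- apply: (@near_eq_is_derive _ _ _ (fun z : R => z^-1 ^+ n * expR (- z^-1) : R)).
    by near=> z; rewrite /flat_exp ifT//; near: z; exact: lt_nbhsr.
  have nx0 : x != 0 by rewrite gt_eqF.
  have dV : is_derive x 1 (fun z : R => z^-1) (- x ^- 2 *: 1).
    by apply: (@is_deriveV R id).
  have dE : is_derive x 1 (fun z : R => expR (- z^-1)) (expR (- x^-1) * - (- x ^- 2 *: 1)).
    apply: (@is_derive1_comp R expR (fun z : R => - z^-1)).
  have dX := is_deriveX n dV; rewrite exprfctE in dX.
  have H := is_deriveM dX dE; rewrite mulrfctE in H; apply: (is_derive_eq H).
  rewrite /flat_exp x0 /GRing.scale/= mulr1 -!exprVn; set y := x^-1.
  case: n {dX H} => [|n]; first by rewrite expr0; ring.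
  by rewrite /= !exprS -natr1; ring.
- rewrite /flat_exp ltxx mulr0 addr0.
  suff C : (fun h : R => h^-1 *: ((flat_exp n \o shift 0) (h *: 1) - flat_exp n 0))
      @ 0^' --> (0 : R).
    by apply: DeriveDef; [apply/cvg_ex; exists 0; exact: C|exact: cvg_lim C].
  apply: norm_cvg0.
  apply: (@squeeze_cvgr _ _ _ _ (cst 0) (fun h => n.+2`!%:R * `|h|)).
  + near=> h; rewrite normr_ge0 /= addr0 /GRing.scale/= mulr1 {2}/flat_exp ltxx subr0.
    have h0 : h != 0 by near: h; exact: nbhs_dnbhs_neq.
    rewrite normrM normfV ler_pdivrMl ?normr_gt0//.
    apply: le_trans (flat_exp_le n h) _.
    by rewrite [leRHS]mulrCA -normrM -expr2 ger0_norm// sqr_ge0.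
  + exact: cvg_cst.
  + rewrite -[X in _ --> X](mulr0 n.+2`!%:R); apply: cvgM; first exact: cvg_cst.
    rewrite -[X in _ --> X](@normr0 _ R); apply: cvg_norm.
    by apply: cvg_within_filter; exact: cvg_id.
Unshelve. all: by end_near. Qed.

Lemma ndiff_flat_exp m n : ndiff m (flat_exp n).
Proof.
elim: m n => // m IH n; apply: ndiffS; first exact: is_derive_flat_exp.
by apply: ndiffD => //; apply: ndiffM => //; exact: ndiff_cst.
Qed.


Lemma test_function_smooth f (a b : R) : smooth f -> 0 < a -> b < 1 ->
  (forall x, ~ (a <= x /\ x <= b) -> f x = 0) -> test_function f.
Proof.
move=> sf a0 b1 fab; split; first exact: smooth_derivable.
by exists a, b.
Qed.

Lemma test_function_out f : test_function f -> f 0 = 0 /\ f 1 = 0.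
Proof.
move=> [_ [a [b [a0 b1 fab]]]]; split; apply: fab => -[].
  by rewrite leNgt a0.
by rewrite [_ <= b]leNgt b1.
Qed.

Lemma test_function_is_derive f (x : R) : test_function f ->
  is_derive x 1 f (derive1 f x).
Proof. by move=> [df _]; rewrite derive1E; apply: derivableP; exact: (df 0%N). Qed.

Lemma test_function_continuous f : test_function f -> continuous f.
Proof.
move=> [df _] x; apply/differentiable_continuous/derivable1_diffP.
exact: (df 0%N).
Qed.

Lemma test_function_derive1 f : test_function f -> test_function (derive1 f).
Proof.
move=> tf; case: (tf) => [df [a [b [a0 b1 fab]]]]; split.
  by move=> n x; rewrite -derive1nSr; exact: df.
exists a, b; split => // x xab.
have [xa|ax] := ltP x a.
  rewrite derive1E (@near_eq_derive _ _ _ _ (cst 0)) ?derive_cst//.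
  near=> z; apply: fab => -[az _]; have : z < a by near: z; exact: lt_nbhsl.
  by rewrite ltNge az.
have bx : b < x by rewrite ltNge; apply/negP => xb; exact: xab.
rewrite derive1E (@near_eq_derive _ _ _ _ (cst 0)) ?derive_cst//.
near=> z; apply: fab => -[_ zb]; have : b < z by near: z; exact: lt_nbhsr.
by rewrite ltNge zb.
Unshelve. all: by end_near. Qed.

Lemma test_function_inL2 f : test_function f -> inL2 f.
Proof.
move=> tf; have cf := test_function_continuous tf.
have [c fc] : exists c : R, forall x, x \in `[0, 1] -> f x <= c.
  have [c _ fc] := EVT_max (@ler01 R) (continuous_subspaceT cf).
  by exists (f c).
have [e fe] : exists e : R, forall x, x \in `[0, 1] -> e <= f x.
  have [c' _ fc'] := EVT_min (@ler01 R) (continuous_subspaceT cf).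
  by exists (f c').
apply: (@bounded_inL2 _ _ (`|c| + `|e|)).
  exact: continuous_measurable_dom.
move=> x; rewrite /dom/= => x01.
have x01' : x \in `[0, 1] by move: x01; rewrite !in_itv/= => /andP[/ltW -> /ltW ->].
have := fc _ x01'; have := fe _ x01'; have := ler_norm c; have := ler_norm (- e).
rewrite normrN ler_norml; have := normr_ge0 c; have := normr_ge0 e.
by move=> *; apply/andP; split; lra.
Qed.

Lemma L2_inner_vareps_derive2 k f : test_function f ->
  L2_inner (vareps k) (derive1 (derive1 f)) =
  - lambda R k ^+ 2 * L2_inner (vareps k) f.
Proof.
move=> tf; have tf1 := test_function_derive1 tf.
have tf2 := test_function_derive1 tf1.
have mD := @measurable_dom R.
set l := lambda R k; set s := Num.sqrt 2 : R.
(* The Wronskian of [vareps k] and f: both integrations by parts are done at once, since its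
   derivative is vareps_k f'' + l^2 vareps_k f, and its boundary values vanish with f and f'. *)
pose F := fun x : R => s * (sin (l * x) * derive1 f x - l * (cos (l * x) * f x)).
pose G := fun x : R =>
  vareps k x * derive1 (derive1 f) x + l ^+ 2 * (vareps k x * f x).
have dF (x : R) : is_derive x 1 F (G x).
  have d0 := test_function_is_derive x tf.
  have d1 := test_function_is_derive x tf1.
  have ds := is_derive_sinM l x; have dc := is_derive_cosM l x.
  have H1 := is_deriveM ds d1; have H2 := is_deriveM dc d0.
  have H3 := is_deriveZ l H2; have H4 := is_deriveB H1 H3.
  have H5 := is_deriveZ s H4.
  apply: (is_derive_eq H5).
  by rewrite /G /GRing.scale/= /vareps -/l -/s; ring.
have cG : continuous G.
  move=> x; apply: cvgD; first apply: cvgM.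
  - exact: continuous_vareps.
  - exact: test_function_continuous.
  - apply: cvgM; first exact: cvg_cst.
    apply: cvgM; first exact: continuous_vareps.
    exact: test_function_continuous.
have := Rintegral_FTC ltr01 cG dF.
have [f0 f1] := test_function_out tf; have [f10 f11] := test_function_out tf1.
rewrite /F f0 f1 f10 f11 !mulr0 subrr.
have hf := test_function_inL2 tf; have hf2 := test_function_inL2 tf2.
have he := @inL2_vareps R k.
rewrite RintegralD//; last 2 first.
- exact: inL2_mul_integrable.
- by apply: integrableRZ => //; exact: inL2_mul_integrable.
rewrite RintegralZl//; last exact: inL2_mul_integrable.
by move=> /eqP; rewrite addr_eq0 => /eqP E; rewrite mulNr -E.
Qed.

Lemma L2_inner_vareps_derive4 k f : test_function f ->
  L2_inner (vareps k) (derive1n 4 f) = lambda R k ^+ 4 * L2_inner (vareps k) f.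
Proof.
move=> tf; have tf2 := test_function_derive1 (test_function_derive1 tf).
rewrite /derive1n/= (L2_inner_vareps_derive2 _ tf2) L2_inner_vareps_derive2//.
by ring.
Qed.

(* exp(-1/t) tends to 1 as t tends to infinity, so these cutoffs of vareps k
   converge to it pointwise on (0,1). *)
Definition cutoff_vareps k (N : nat) (x : R) : R :=
  vareps k x * (flat_exp 0 (N.+1%:R * x + (-1)) *
                flat_exp 0 (- N.+1%:R * x + N%:R)).

Lemma flat_exp0_le1 (x : R) : 0 <= flat_exp 0 x <= 1.
Proof.
rewrite /flat_exp; case: ifPn => [x0|_]; last by rewrite lexx ler01.
by rewrite mul1r expR_ge0/= -expR0 ler_expR oppr_le0 invr_ge0 ltW.
Qed.

Lemma flat_exp0_ge (x : R) : 0 < x -> 1 - x^-1 <= flat_exp 0 x.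
Proof.
by move=> x0; rewrite /flat_exp x0 mul1r (le_trans _ (expR_ge1Dx _)).
Qed.

Lemma cutoff_vareps_test k N : test_function (cutoff_vareps k N).
Proof.
have N0 : (0 : R) < N.+1%:R by rewrite ltr0n.
apply: (@test_function_smooth _ N.+1%:R^-1 (N%:R / N.+1%:R)).
- move=> n; apply: ndiffM; last by apply: ndiffM; apply: ndiff_affine; exact: ndiff_flat_exp.
  have := ndiff_trigo n (Num.sqrt 2) 0 (lambda R k).
  by under eq_fun do rewrite mul0r addr0.
- by rewrite invr_gt0.
- by rewrite ltr_pdivrMr// mul1r ltr_nat.
- move=> x H; rewrite /cutoff_vareps.
  have [xa|ax] := ltP x N.+1%:R^-1.
    rewrite flat_exp_eq0 ?mul0r ?mulr0//.
    by rewrite subr_le0 -ler_pdivlMl// mulr1 ltW.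
  have bx : N%:R / N.+1%:R < x by rewrite ltNge; apply/negP => xb; exact: H.
  rewrite [X in _ * (_ * X)]flat_exp_eq0 ?mulr0//.
  by rewrite mulNr addrC subr_le0 -ler_pdivrMl// mulrC ltW.
Qed.

Lemma cutoff_vareps_le k N x : `|cutoff_vareps k N x| <= 2.
Proof.
rewrite normrM -[leRHS]mulr1 ler_pM ?vareps_le2//.
have /andP[a0 a1] := flat_exp0_le1 (N.+1%:R * x + (-1)).
have /andP[b0 b1] := flat_exp0_le1 (- N.+1%:R * x + N%:R).
by rewrite ger0_norm ?mulr_ge0// mulr_ile1.
Qed.

Lemma cvg_flat_exp0 (c e : R) : 0 < c ->
  flat_exp 0 (N%:R * c + e) @[N --> \oo] --> (1 : R).
Proof.
move=> c0.
have ty : (N%:R * c + e) @[N --> \oo] --> +oo.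
  apply/cvgryPge => A; near=> N; rewrite -lerBlDr -ler_pdivrMr//.
  by near: N; exact: nbhs_infty_ger.
apply: (@squeeze_cvgr _ _ _ _ (fun N => 1 - (N%:R * c + e)^-1) (cst 1)).
- near=> N; have /andP[_ ->] := flat_exp0_le1 (N%:R * c + e); rewrite andbT.
  apply: flat_exp0_ge; near: N; move/cvgryPgt : ty; exact.
- rewrite -[X in _ --> X]subr0; apply: cvgB; first exact: cvg_cst.
  apply/gtr0_cvgV0 => //; near=> N; near: N; move/cvgryPgt : ty; exact.
- exact: cvg_cst.
Unshelve. all: by end_near. Qed.

Lemma cvg_cutoff_vareps k x : dom R x ->
  cutoff_vareps k N x @[N --> \oo] --> vareps k x.
Proof.
rewrite /dom/= in_itv/= => /andP[x0 x1]; rewrite -[X in _ --> X]mulr1.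
apply: cvgM; first exact: cvg_cst.
rewrite -[X in _ --> X]mulr1; apply: cvgM.
  have := @cvg_flat_exp0 x (x - 1) x0; apply: cvg_trans; apply: near_eq_cvg.
  by near=> N; congr flat_exp; rewrite -natr1; ring.
have y0 : 0 < 1 - x by rewrite subr_gt0.
have := @cvg_flat_exp0 (1 - x) (- x) y0; apply: cvg_trans; apply: near_eq_cvg.
by near=> N; congr flat_exp; rewrite -natr1; ring.
Unshelve. all: by end_near. Qed.

End smooth_functions.

(** * Sine series and weak fourth derivatives *)

Section sine_series.
Variable R : realType.
Notation mu := (@lebesgue_measure R).
Implicit Types f g h : R -> R.

Lemma is_cvg_sum1_abs_bounded (u : nat -> R) (B : R) :
  (forall n, \sum_(1 <= k < n) `|u k| <= B) ->
  cvgn (fun n => \sum_(1 <= k < n) u k).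
Proof.
move=> uB; suff : cvgn (series (fun k => u k.+1)).
  move=> /cvg_ex[l ul]; apply/cvg_ex; exists l; rewrite -cvg_shiftS.
  rewrite (_ : [sequence _]_n = series (fun k => u k.+1))//.
  by apply/funext => n /=; rewrite big_add1.
apply: normed_cvg; apply: nondecreasing_is_cvgn.
  by apply: nondecreasing_series => k _ _; exact: normr_ge0.
exists B => _ [n _ <-]; apply: le_trans (uB n.+1).
by rewrite /series/= big_add1.
Qed.

Lemma sum_invr_sqr_le n : \sum_(1 <= k < n) (k%:R ^+ 2)^-1 <= 2 :> R.
Proof.
suff H m : \sum_(1 <= k < m.+2) (k%:R ^+ 2)^-1 <= 2 - m.+1%:R^-1 :> R.
  case: n => [|[|n]]; [by rewrite big_geq|by rewrite big_geq|].
  by rewrite (le_trans (H _))// gerBl invr_ge0.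
elim: m => [|m IH]; first by rewrite big_nat1 expr1n invr1; lra.
rewrite big_nat_recr//= (le_trans (lerD IH (lexx _)))//.
have m1 : 0 < m.+1%:R :> R by rewrite ltr0n.
have m2 : 0 < m.+2%:R :> R by rewrite ltr0n.
rewrite -subr_ge0 (_ : _ - _ = (m.+1%:R * m.+2%:R ^+ 2)^-1).
  by rewrite invr_ge0 mulr_ge0 ?sqr_ge0 ?ltW.
have e : m.+2%:R = m.+1%:R + 1 :> R by rewrite natr1.
by move: m1 m2; rewrite e; set x := m.+1%:R => m1 m2; field; rewrite !gt_eqF.
Qed.

Lemma inL2_eq_of_coef f g : inL2 f -> inL2 g ->
  (forall k, (1 <= k)%N -> L2_inner f (vareps k) = L2_inner g (vareps k)) ->
  {ae mu, forall x, dom R x -> f x = g x}.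
Proof.
move=> hf hg fg; have hfg := inL2B hf hg.
have s0 : Num.sqrt 2 != 0 :> R by rewrite gt_eqF// sqrtr_gt0.
have H k : (1 <= k)%N ->
    \int[mu]_(x in dom R) ((f x - g x) * sin (lambda R k * x)) = 0.
  move=> k1; have := L2_innerBl hf hg (@inL2_vareps R k).
  rewrite fg// subrr.
  have -> : L2_inner (fun x => f x - g x) (vareps k) = Num.sqrt 2 *
      \int[mu]_(x in dom R) ((f x - g x) * sin (lambda R k * x)).
    rewrite -RintegralZl//; [|exact: measurable_dom|].
      by apply: eq_Rintegral => x _; rewrite /vareps mulrCA.
    apply: integrable_mul_bounded (fun x _ => sin_max _) => //.
    - exact: measurable_dom.
    - exact: inL2_integrable.
    - by apply: continuous_measurable_dom; exact: continuous_sinM.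
  by move=> /eqP; rewrite mulf_eq0 (negbTE s0) => /eqP.
have := sine_complete (inL2_integrable hfg) H.
apply: filterS; first exact: (ae_filter_ringOfSetsType mu).
by move=> x + Dx => /(_ Dx)/eqP; rewrite subr_eq0 => /eqP.
Qed.

Lemma lambda_ge_nat k : k%:R <= lambda R k.
Proof.
rewrite /lambda ler_peMr// (le_trans _ (pi_ge2 R))//; lra.
Qed.

Section rapid_coefficients.
Variables (g : R -> R) (K : R).
Hypothesis hg : inL2 g.
Hypothesis gK : forall n,
  \sum_(1 <= k < n) lambda R k ^+ 8 * L2_inner g (vareps k) ^+ 2 <= K.

Lemma rapid_coef_ge0 : 0 <= K.
Proof. by have := gK 0; rewrite big_geq. Qed.

(** A single term of the sum gives |lambda_k^4 g_k| <= sqrt K <= 1 + K. Of the decay k^(-4) only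
    k^(-2) is kept: it already makes the sine series converge absolutely and uniformly. *)
Lemma rapid_coef_le k : (1 <= k)%N ->
  `|L2_inner g (vareps k)| <= (1 + K) * (k%:R ^+ 2)^-1.
Proof.
move=> k1; set c := L2_inner g (vareps k).
have K0 := rapid_coef_ge0.
have cK : lambda R k ^+ 8 * c ^+ 2 <= K.
  apply: le_trans (gK k.+1); rewrite big_nat_recr//= lerDr.
  by rewrite sumr_ge0// => i _; rewrite mulr_ge0 ?sqr_ge0 ?exprn_even_ge0.
have lk : 1 <= k%:R :> R by rewrite ler1n.
have ll := lambda_ge_nat k.
have l4 : k%:R ^+ 2 <= lambda R k ^+ 4.
  apply: le_trans (_ : k%:R ^+ 4 <= _).
    by rewrite ler_weXn2l.
  by rewrite lerXn2r ?nnegrE//; lra.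
have k20 : 0 < k%:R ^+ 2 :> R by rewrite exprn_gt0//; lra.
rewrite ler_pdivlMr// -[X in _ * X <= _]gtr0_norm// -normrM.
have : (lambda R k ^+ 4 * c) ^+ 2 <= K by rewrite exprMn -exprM.
set d := lambda R k ^+ 4 * c => dK.
apply: (@le_trans _ _ `|d|).
  rewrite /d [leLHS]normrM [leRHS]normrM mulrC ler_wpM2r//.
  by rewrite (gtr0_norm k20) (gtr0_norm (lt_le_trans k20 l4)).
rewrite -(real_normK (num_real d)) in dK.
by have := normr_ge0 d; nra.
Qed.

Let S n x := \sum_(1 <= j < n) L2_inner g (vareps j) * vareps j x.

Lemma rapid_abs_series_le n x :
  \sum_(1 <= j < n) `|L2_inner g (vareps j) * vareps j x| <= 4 * (1 + K).
Proof.
have K0 := rapid_coef_ge0.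
apply: le_trans (_ : \sum_(1 <= j < n) (2 * (1 + K)) * (j%:R ^+ 2)^-1 <= _).
  apply: ler_sum_nat => j /andP[j1 _].
  rewrite normrM -mulrA mulrC ler_pM ?vareps_le2//.
  exact: rapid_coef_le.
rewrite -mulr_sumr; have := sum_invr_sqr_le n.
set s := \sum_(_ <= _ < _) _ => s2.
by nra.
Qed.

Lemma rapid_series_le n x : `|S n x| <= 4 * (1 + K).
Proof. exact: le_trans (ler_norm_sum _ _ _) (rapid_abs_series_le n x). Qed.

(** The partial sums are uniformly bounded and converge pointwise to some G, so dominated
    convergence applies to every inner product. G has the coefficients of g, hence equals g almost
    everywhere by completeness of the sines. *)
Lemma cvg_rapid_series_inner psi : inL2 psi ->
  (fun n => \sum_(1 <= j < n) L2_inner g (vareps j) * L2_inner (vareps j) psi) @ \oo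
    --> L2_inner g psi.
Proof.
have K0 := rapid_coef_ge0; have mD := @measurable_dom R.
pose G x := limn (fun n => S n x).
have cS x : S n x @[n --> \oo] --> G x.
  exact: is_cvg_sum1_abs_bounded (fun n => rapid_abs_series_le n x).
have hS n : inL2 (S n) by apply: inL2_sum => j; exact/inL2Z/inL2_vareps.
have mG : measurable_fun (dom R) G.
  by apply: (@measurable_fun_cvg _ _ _ _ S) => // n; exact: inL2_measurable (hS n).
have Gle x : `|G x| <= 4 * (1 + K).
  apply: (cvgr_to_le (cvg_norm (cS x))).
  by near=> n; exact: rapid_series_le.
have hG : inL2 G by apply: (bounded_inL2 mG) => x _; exact: Gle.
have cI psi' : inL2 psi' -> L2_inner (S n) psi' @[n --> \oo] --> L2_inner G psi'.
  move=> hp; have mp := inL2_measurable hp.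
  apply: (@Rintegral_dominated _ _ _ mu _ _ _ (fun x => 4 * (1 + K) * `|psi' x|)) => //.
  - by move=> n; apply: measurable_funM => //; exact: inL2_measurable (hS n).
  - exact: measurable_funM.
  - by apply: integrableRZ => //; exact/integrable_norm/inL2_integrable.
  - by move=> x _; apply: cvgM; [exact: cS|exact: cvg_cst].
  - by move=> n x _; rewrite normrM ler_wpM2r// rapid_series_le.
have SI n psi' : inL2 psi' -> L2_inner (S n) psi' =
    \sum_(1 <= j < n) L2_inner g (vareps j) * L2_inner (vareps j) psi'.
  move=> hp; rewrite L2_inner_suml//; last first.
    by move=> j; exact/inL2Z/inL2_vareps.
  by apply: eq_bigr => j _; rewrite L2_innerZl//; exact: inL2_vareps.
have Ggk k : (1 <= k)%N -> L2_inner G (vareps k) = L2_inner g (vareps k).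
  move=> k1; have hk := @inL2_vareps R k.
  have := cI _ hk => /(cvg_unique (@Rhausdorff R)); apply.
  apply: cvg_near_cst; near=> n.
  have kn : (k < n)%N by near: n; exact: nbhs_infty_gt.
  rewrite SI// (bigD1_seq k)/= ?mem_index_iota ?k1 ?iota_uniq//.
  rewrite L2_inner_vareps// eqxx mulr1 big_nat_cond big1 ?addr0// => j.
  by move=> /andP[/andP[j1 _] jk]; rewrite L2_inner_vareps ?(negbTE jk) ?mulr0.
move=> hpsi; have GE := inL2_eq_of_coef hG hg Ggk.
rewrite -(ae_eq_L2_inner hG hg hpsi GE).
have := cI _ hpsi; apply: cvg_trans; apply: near_eq_cvg.
by near=> n; rewrite SI.
Unshelve. all: by end_near. Qed.

(** For a test function phi, the sine series of g turns the inner product of g with phi'''' into the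
    sum of a_j times the coefficients of phi, with a_j = lambda_j^4 g_j. As (a_j) is square
    summable, phi may be replaced in the limit by [vareps k], although the latter is not compactly
    supported in (0,1). *)
Lemma weak_deriv4_coef h k : weak_deriv4 g h -> (1 <= k)%N ->
  L2_inner h (vareps k) = lambda R k ^+ 4 * L2_inner g (vareps k).
Proof.
move=> [hh gh] k1; have K0 := rapid_coef_ge0; have mD := @measurable_dom R.
set a := fun j => lambda R j ^+ 4 * L2_inner g (vareps j).
have hk := @inL2_vareps R k.
pose phi N := cutoff_vareps (R := R) k N.
have tphi N : test_function (phi N) by exact: cutoff_vareps_test.
have hphi N : inL2 (phi N) by exact: test_function_inL2.
pose D N := L2_inner (fun x => phi N x - vareps k x) (fun x => phi N x - vareps k x).
have D0 : D N @[N --> \oo] --> 0.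
  rewrite -[X in _ --> X](@L2_inner0l _ (fun=> 0)).
  apply: (@Rintegral_dominated _ _ _ mu _ _ _ (fun=> 16)) => //.
  - by move=> N; apply: measurable_funM; apply: inL2_measurable; exact: inL2B.
  - apply: (@integrable_bounded_fun _ _ _ mu _ _ 16) => //.
      by rewrite [X in (X < _)%E]lebesgue_measure_dom ltry.
    by move=> x _; rewrite ger0_norm.
  - move=> x Dx; rewrite mul0r -[X in _ --> X](mulr0 0).
    have c0 : phi N x - vareps k x @[N --> \oo] --> (0 : R).
      rewrite -[X in _ --> X](subrr (vareps k x)); apply: cvgB.
        exact: cvg_cutoff_vareps.
      exact: cvg_cst.
    exact: cvgM.
  - move=> N x _; rewrite -expr2 ger0_norm ?sqr_ge0//.
    have := cutoff_vareps_le k N x; have := vareps_le2 k x.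
    rewrite !ler_norml -/(phi N x) => /andP[? ?] /andP[? ?]; nra.
(* Young's inequality with weight [eta] plays the part of Cauchy-Schwarz: [K] controls the squares
   of the a_j, and Bessel's inequality those of the coefficients of phi N - vareps k. N goes to
   infinity at fixed [eta], and [eta] to 0 afterwards. *)
have HN N (eta : R) : 0 < eta ->
    `|L2_inner h (phi N) - a k| <= eta * K / 2 + (eta^-1 / 2) * D N.
  move=> eta0.
  have ei : 0 < eta^-1 by rewrite invr_gt0.
  have hd : inL2 (fun x => phi N x - vareps k x) by exact: inL2B.
  have t4 : test_function (derive1n 4 (phi N)).
    by do 4 apply: test_function_derive1.
  have := cvg_rapid_series_inner (test_function_inL2 t4); rewrite gh//.
  move=> C.
  have C2 : `|\sum_(1 <= j < n) L2_inner g (vareps j) *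
      L2_inner (vareps j) (derive1n 4 (phi N)) - a k| @[n --> \oo] -->
      `|L2_inner h (phi N) - a k|.
    by apply: cvg_norm; apply: cvgB => //; exact: cvg_cst.
  apply: (cvgr_to_le C2); near=> n.
  have kn : (k < n)%N by near: n; exact: nbhs_infty_gt.
  have -> : \sum_(1 <= j < n) L2_inner g (vareps j) *
      L2_inner (vareps j) (derive1n 4 (phi N)) - a k =
      \sum_(1 <= j < n) a j * L2_inner (fun x => phi N x - vareps k x) (vareps j).
    have -> : a k = \sum_(1 <= j < n) a j * L2_inner (vareps k) (vareps j).
      rewrite (bigD1_seq k)/= ?mem_index_iota ?k1 ?iota_uniq//.
      rewrite L2_inner_vareps// eqxx mulr1 big_nat_cond big1 ?addr0// => j.
      by move=> /andP[/andP[j1 _] jk]; rewrite L2_inner_vareps 1?eq_sym ?(negbTE jk) ?mulr0.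
    rewrite -sumrB; apply: eq_bigr => j _.
    rewrite L2_inner_vareps_derive4// L2_innerBl//; last exact: inL2_vareps.
    by rewrite /a (L2_innerC (vareps j)); ring.
  rewrite (le_trans (ler_norm_sum _ _ _))//.
  apply: le_trans (_ : \sum_(1 <= j < n) (eta / 2 * (lambda R j ^+ 8 * L2_inner g (vareps j) ^+ 2)
     + eta^-1 / 2 * L2_inner (fun x => phi N x - vareps k x) (vareps j) ^+ 2) <= _).
    apply: ler_sum => j _.
    set b := L2_inner (fun x => _) _.
    have -> : lambda R j ^+ 8 * L2_inner g (vareps j) ^+ 2 = a j ^+ 2.
      by rewrite /a [RHS]exprMn -[in RHS]exprM.
    rewrite normrM -(real_normK (num_real (a j))) -(real_normK (num_real b)).
    set x := `|a j|; set y := `|b|.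
    have : 0 <= eta^-1 * (eta * x - y) ^+ 2 by rewrite mulr_ge0 ?sqr_ge0 ?ltW.
    have -> : eta^-1 * (eta * x - y) ^+ 2 = eta * x ^+ 2 - 2 * x * y + eta^-1 * y ^+ 2.
      by field; rewrite gt_eqF.
    by move=> ?; lra.
  rewrite big_split/= -!mulr_sumr; apply: lerD.
    by rewrite mulrAC ler_wpM2r// ler_wpM2l// ltW.
  by apply: ler_wpM2l; [lra|exact: bessel].
have Hlim (eta : R) : 0 < eta -> `|L2_inner h (vareps k) - a k| <= eta * K / 2.
  move=> eta0.
  have C : L2_inner h (phi N) @[N --> \oo] --> L2_inner h (vareps k).
    apply: (@Rintegral_dominated _ _ _ mu _ _ _ (fun x => 2 * `|h x|)) => //.
    - by move=> N; apply: measurable_funM; exact: inL2_measurable.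
    - by apply: measurable_funM; exact: inL2_measurable.
    - by apply: integrableRZ => //; exact/integrable_norm/inL2_integrable.
    - by move=> x Dx; apply: cvgM; [exact: cvg_cst|exact: cvg_cutoff_vareps].
    - by move=> N x _; rewrite normrM mulrC ler_wpM2r// cutoff_vareps_le.
  have L : `|L2_inner h (phi N) - a k| @[N --> \oo] -->
      `|L2_inner h (vareps k) - a k|.
    by apply: cvg_norm; apply: cvgB => //; exact: cvg_cst.
  have U : eta * K / 2 + (eta^-1 / 2) * D N @[N --> \oo] --> eta * K / 2.
    rewrite -[X in _ --> X]addr0; apply: cvgD; first exact: cvg_cst.
    by rewrite -[X in _ --> X](mulr0 (eta^-1 / 2)); apply: cvgM => //; exact: cvg_cst.
  by apply: (ler_cvg_to L U); near=> N; exact: HN.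
apply/eqP; rewrite -subr_eq0 -normr_le0.
apply/ler_addgt0Pr => e e0; rewrite add0r.
have K1 : 0 < K + 1 by lra.
have eK : 0 < e / (K + 1) by rewrite divr_gt0.
apply: (le_trans (Hlim _ eK)).
rewrite ler_pdivrMr// mulrAC ler_pdivrMr//; nra.
Unshelve. all: by end_near. Qed.

End rapid_coefficients.

End sine_series.

(** * The Crank-Nicolson kernel *)

Section crank_nicolson_kernel.
Variable R : realType.
Notation mu := (@lebesgue_measure R).

(* For x = mu * tau, one Crank-Nicolson step of u' + mu u = f over a step of
   length tau is u |-> cn_ratio x * u + cn_gain x * (integral of f). *)
Definition cn_ratio (x : R) := (1 - x / 2) / (1 + x / 2).
Definition cn_gain (x : R) := (1 + x / 2)^-1.

Section pointwise.
Variables (x : R) (x_gt0 : 0 < x).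
Let r := cn_ratio x.
Let b := cn_gain x.
Let q := (1 + x)^-1.


(** Absorbs the linear growth of the accumulated error. By (1 + x/3)^2 <= 1 + x and Bernoulli, (1 +
    j x/3)^2 <= (1 + x)^j; the constant is 3^2. *)
Lemma sqr_natr_mul_le j : x <= 1 -> (j%:R * x) ^+ 2 * q ^+ j <= 9.
Proof.
move=> x1; have x0 := x_gt0; have q0 : 0 < (1 + x) ^+ j by rewrite exprn_gt0//; lra.
rewrite /q exprVn ler_pdivrMr//.
have B : (1 + j%:R * (x / 3)) ^+ 2 <= (1 + x) ^+ j.
  apply: (@le_trans _ _ (((1 + x / 3) ^+ j) ^+ 2)).
    have jx : 0 <= j%:R * (x / 3) by rewrite mulr_ge0//; lra.
    have a0 : 0 <= 1 + x / 3 by lra.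
    have a1 : 0 <= 1 + j%:R * (x / 3) by lra.
    rewrite lerXn2r ?nnegrE ?exprn_ge0//.
    by apply: bernoulli_inequality; lra.
  have a1 : (1 + x / 3) ^+ 2 <= 1 + x by nra.
  have a2 : 0 <= 1 + x by lra.
  by rewrite -exprM mulnC exprM lerXn2r ?nnegrE ?sqr_ge0.
have j0 : 0 <= j%:R * x by rewrite mulr_ge0// ltW.
have -> : (j%:R * x) ^+ 2 = 9 * (j%:R * (x / 3)) ^+ 2 by field.
rewrite ler_pM2l//; apply: le_trans B.
have a3 : 0 <= j%:R * (x / 3) by rewrite mulrA divr_ge0.
by rewrite lerXn2r ?nnegrE//; lra.
Qed.

(** Both r and E = exp(-x) lie in [1 - x, q], whose length is at most x^2, while b and exp(-th x)
    lie in [1 - x, 1]. The difference is thus at most x q^j (1 + 2z) with z = j x; since (1 + 2z)^2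
    <= 2 + 8 z^2 and z^2 q^j <= 9, squaring yields 2 + 8 * 9 = 74. *)
Lemma kernel_diff_sqr_le j (th : R) : x <= 1 -> 0 <= th <= 1 ->
  (b * r ^+ j - expR (- ((j%:R + th) * x))) ^+ 2 <= 74 * x ^+ 2 * q ^+ j.
Proof.
move=> x1 /andP[th0 th1]; have x0 := x_gt0.
pose E := expR (- x).
have q1 : q <= 1 by rewrite /q invf_le1; lra.
have q12 : 2^-1 <= q by rewrite /q lef_pV2 ?posrE; lra.
have qE : q * (1 + x) = 1 by rewrite /q mulVf// gt_eqF//; lra.
have x2 : 0 < 1 + x / 2 by lra.
have bE : b * (1 + x / 2) = 1 by rewrite /b /cn_gain mulVf// gt_eqF.
have rE : r * (1 + x / 2) = 1 - x / 2 by rewrite /r /cn_ratio mulfVK// gt_eqF.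
have r0 : 0 <= r by rewrite /r /cn_ratio divr_ge0; lra.
have rq : r <= q.
  rewrite -(ler_pM2r x2) rE; nra.
have E0 : 0 <= E by exact: expR_ge0.
have exp_le (y : R) : 0 <= y -> expR (- y) * (1 + y) <= 1.
  move=> y0; rewrite expRN -ler_pdivlMl ?invr_gt0 ?expR_gt0// invrK mulr1.
  exact: expR_ge1Dx.
have Eq : E <= q.
  have := exp_le _ (ltW x_gt0); rewrite -/E => H; nra.
have E1 : 1 - x <= E by exact: expR_ge1Dx.
have r1 : 1 - x <= r by rewrite -(ler_pM2r x2) rE; nra.
have qx : q <= 1 - x + x ^+ 2 by nra.
have rE2 : `|r - E| <= x ^+ 2 by rewrite ler_norml; apply/andP; split; nra.
have qj0 i : 0 <= q ^+ i by rewrite exprn_ge0//; lra.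
have rj i : 0 <= r ^+ i <= q ^+ i.
  by rewrite exprn_ge0//= lerXn2r ?nnegrE//; lra.
have Ej i : 0 <= E ^+ i <= q ^+ i.
  by rewrite exprn_ge0//= lerXn2r ?nnegrE//; lra.
(* Telescoping gives i q^(i-1) x^2; the factor 2 restores the missing power of q, as q >= 1/2. *)
have H i : `|r ^+ i - E ^+ i| <= 2 * i%:R * q ^+ i * x ^+ 2.
  elim: i => [|i IH]; first by rewrite !expr0 subrr normr0 mulr0 !mul0r.
  have -> : r ^+ i.+1 - E ^+ i.+1 = r * (r ^+ i - E ^+ i) + E ^+ i * (r - E).
    by rewrite !exprS; ring.
  rewrite (le_trans (ler_normD _ _))// [`|r * _|]normrM [`|_ ^+ i * _|]normrM (ger0_norm r0).
  have /andP[e0 e1] := Ej i; rewrite (ger0_norm e0).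
  apply: (@le_trans _ _ (q * (2 * i%:R * q ^+ i * x ^+ 2) + q ^+ i * x ^+ 2)).
    by rewrite lerD// ler_pM.
  rewrite -[i.+1%:R]natr1 (exprS q i); have := mulr_ge0 (qj0 i) (sqr_ge0 x).
  set A := q ^+ i * x ^+ 2 => A0.
  have -> : q * (2 * i%:R * q ^+ i * x ^+ 2) = 2 * i%:R * q * A by rewrite /A; ring.
  have -> : 2 * (i%:R + 1) * (q * q ^+ i) * x ^+ 2 = 2 * i%:R * q * A + 2 * q * A.
    by rewrite /A; ring.
  nra.
pose F := expR (- (th * x)).
have thx : 0 <= th * x by rewrite mulr_ge0// ltW.
have F1 : F <= 1 by rewrite /F -expR0 ler_expR oppr_le0.
have F0 : 0 <= F by exact: expR_ge0.
have Fx : 1 - x <= F.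
  by apply: le_trans (expR_ge1Dx _); nra.
have b1 : b <= 1 by nra.
have bx : 1 - x <= b by nra.
have -> : expR (- ((j%:R + th) * x)) = F * E ^+ j.
  by rewrite /F /E -expRM_natl -expRD; congr expR; ring.
have /andP[rj0 rj1] := rj j.
have K : `|b * r ^+ j - F * E ^+ j| <= x * q ^+ j + 2 * j%:R * q ^+ j * x ^+ 2.
  have -> : b * r ^+ j - F * E ^+ j = (b - F) * r ^+ j + F * (r ^+ j - E ^+ j) by ring.
  rewrite (le_trans (ler_normD _ _))// [`|_ * r ^+ j|]normrM [`|F * _|]normrM.
  rewrite (ger0_norm rj0) (ger0_norm F0).
  rewrite lerD//.
    by rewrite ler_pM// ler_norml; apply/andP; split; lra.
  by rewrite -[leRHS]mul1r ler_pM.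
rewrite -(real_normK (num_real (_ - _))).
have S := sqr_natr_mul_le j x1.
have qj1 : q ^+ j <= 1 by rewrite exprn_ile1//; lra.
set N := `|_|; rewrite -/N in K.
have N0 : 0 <= N by exact: normr_ge0.
have K2 : N <= x * (q ^+ j * (1 + 2 * (j%:R * x))).
  by apply: le_trans K _; rewrite le_eqVlt; apply/orP; left; apply/eqP; ring.
apply: (@le_trans _ _ ((x * (q ^+ j * (1 + 2 * (j%:R * x)))) ^+ 2)).
  by rewrite lerXn2r ?nnegrE//; exact: le_trans K2.
rewrite exprMn [leRHS]mulrC [leRHS]mulrA [leRHS]mulrC ler_wpM2l ?sqr_ge0//.
move: S (qj0 j) qj1; set Q := q ^+ j; set z := j%:R * x => S Q0 Q1.
have z2 : (1 + 2 * z) ^+ 2 <= 2 + 8 * z ^+ 2.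
  by have := sqr_ge0 (1 - 2 * z); nra.
have T : Q ^+ 2 * (1 + 2 * z) ^+ 2 <= Q ^+ 2 * (2 + 8 * z ^+ 2).
  by rewrite ler_wpM2l// sqr_ge0.
rewrite [(Q * _) ^+ 2]exprMn; apply: (le_trans T).
have -> : Q ^+ 2 * (2 + 8 * z ^+ 2) = Q * (2 * Q + 8 * (z ^+ 2 * Q)) by ring.
rewrite ler_wpM2l//; lra.
Qed.

End pointwise.

End crank_nicolson_kernel.

(** * Mean square of the kernel and its sum over the modes *)

Section crank_nicolson_kernel_integral.
Variable R : realType.
Notation mu := (@lebesgue_measure R).

Lemma sum_geometric_le (z : R) n : 0 <= z < 1 -> \sum_(j < n) z ^+ j <= (1 - z)^-1.
Proof.
move=> /andP[z0 z1]; rewrite -[leRHS]mul1r ler_pdivlMr ?subr_gt0//.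
have : z ^+ n - 1 = (z - 1) * \sum_(j < n) z ^+ j := subrX1 _ _.
have := exprn_ge0 n z0; lra.
Qed.

(** Half-open, so that consecutive cells tile [[0, m tau[] exactly; the open cells [grid_cell] of
    the noise are contained in cells of this form. *)
Definition cell (tau : R) (l : nat) : set R := `[l%:R * tau, l.+1%:R * tau[.

#[local] Hint Extern 0 (measurable (cell _ _)) => solve [exact: measurable_itv] : core.

Definition cn_steps (tau x : R) (m : nat) (s : R) : R :=
  \sum_(l < m) cn_gain x * cn_ratio x ^+ (m - l.+1) * \1_(cell tau l) s.

Definition cn_kernel (tau mu0 : R) (m : nat) (s : R) : R :=
  cn_steps tau (mu0 * tau) m s - expR (- (mu0 * (m%:R * tau - s))).

Section fixed_step.
Variables (tau mu0 : R) (tau_gt0 : 0 < tau) (mu0_gt0 : 0 < mu0).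
Let x := mu0 * tau.

Lemma mulr_natl_le (k l : nat) : (k <= l)%N -> k%:R * tau <= l%:R * tau.
Proof. by move=> kl; rewrite ler_pM2r// ler_nat. Qed.

Lemma cell_inj (k l : nat) (s : R) : cell tau k s -> cell tau l s -> k = l.
Proof.
wlog kl : k l / (k <= l)%N.
  by move=> H ks ls; case: (leqP k l) => [kl|/ltnW lk]; [|apply/esym]; exact: H.
rewrite /cell/= !in_itv/= => /andP[_ ks] /andP[ls _].
apply/eqP; rewrite eqn_leq kl/= leqNgt; apply/negP => /mulr_natl_le H.
by have := lt_le_trans ks (le_trans H ls); rewrite ltxx.
Qed.

Lemma lebesgue_measure_cell l : mu (cell tau l) = tau%:E.
Proof.
have lt : l%:R * tau < l.+1%:R * tau by rewrite ltr_pM2r// ltr_nat.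
rewrite /cell lebesgue_measure_itv/= lte_fin lt -EFinB; congr EFin.
by rewrite -natr1; ring.
Qed.

Lemma cell_sub m l : (l < m)%N -> cell tau l `<=` `[0, m%:R * tau[.
Proof.
move=> lm s; rewrite /cell/= !in_itv/= => /andP[a b]; apply/andP; split.
  by rewrite (le_trans _ a)// mulr_ge0// ltW.
exact: lt_le_trans b (mulr_natl_le lm).
Qed.

Lemma Rintegral_cells (f : R -> R) m :
  mu.-integrable `[0, m%:R * tau[ (EFin \o f) ->
  \int[mu]_(s in `[0, m%:R * tau[) f s = \sum_(l < m) \int[mu]_(s in cell tau l) f s.
Proof.
elim: m => [|m IH] iF.
  by rewrite big_ord0 mul0r set_itvco0 Rintegral_set0.
have E : `[0, m.+1%:R * tau[%classic = `[0, m%:R * tau[%classic `|` cell tau m :> set R.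
  rewrite /cell -itv_bndbnd_setU ?bnd_simp//.
    by rewrite mulr_ge0// ltW.
  exact: mulr_natl_le.
rewrite big_ord_recr/= E Rintegral_setU//; last 2 first.
- by rewrite -E.
- apply/disj_setPS => s [/=]; rewrite /cell/= !in_itv/= => /andP[_ a] /andP[b _].
  by have := lt_le_trans a b; rewrite ltxx.
rewrite IH//; apply: integrableS iF => //.
by rewrite E; exact: subsetUl.
Qed.

Lemma cn_steps_cell m l s : (l < m)%N -> cell tau l s ->
  cn_steps tau x m s = cn_gain x * cn_ratio x ^+ (m - l.+1).
Proof.
move=> lm ls; rewrite /cn_steps (bigD1 (Ordinal lm))//= indicE mem_set// mulr1.
rewrite big1 ?addr0// => k /eqP kl; rewrite indicE memNset ?mulr0//.
by move=> ks; apply: kl; apply: val_inj => /=; exact: (cell_inj ks ls).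
Qed.

Lemma measurable_cn_steps m D : measurable_fun D (cn_steps tau x m).
Proof.
apply: (@measurable_sum _ _ _ _ _ _ (fun l : 'I_m => fun s =>
  cn_gain x * cn_ratio x ^+ (m - l.+1) * \1_(cell tau l) s)) => l.
by apply: measurable_funM => //; apply: measurable_indic; exact: measurable_itv.
Qed.

Lemma continuous_expR_affine (c e : R) : continuous (fun s : R => expR (c * (e - s))).
Proof.
move=> s; apply: (@continuous_comp _ _ _ (fun s => c * (e - s)) (@expR R)).
  apply: cvgM; first exact: cvg_cst.
  by apply: cvgB; [exact: cvg_cst|exact: cvg_id].
exact: continuous_expR.
Qed.

Lemma continuous_decay m : continuous (fun s : R => expR (- (mu0 * (m%:R * tau - s)))).
Proof.
have := @continuous_expR_affine (- mu0) (m%:R * tau).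
by under eq_fun do rewrite mulNr.
Qed.

Lemma measurable_cn_kernel m D : measurable_fun D (cn_kernel tau mu0 m).
Proof.
apply: measurable_funB; first exact: measurable_cn_steps.
by apply: measurable_funTS; apply: continuous_measurable_fun; exact: continuous_decay.
Qed.

Lemma cn_kernel_bounded m : exists B : R, forall s, s < m%:R * tau ->
  `|cn_kernel tau mu0 m s| <= B.
Proof.
exists (\sum_(l < m) `|cn_gain x * cn_ratio x ^+ (m - l.+1)| + 1) => s sm.
rewrite (le_trans (ler_normB _ _))// lerD//.
  rewrite (le_trans (ler_norm_sum _ _ _))//; apply: ler_sum => l _.
  rewrite normrM ler_piMr// indicE.
  by case: (_ \in _); rewrite ?normr0 ?normr1.
rewrite ger0_norm ?expR_ge0// -[leRHS]expR0 ler_expR oppr_le0.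
by apply: mulr_ge0; [exact: ltW|rewrite subr_ge0 ltW].
Qed.

Lemma integrable_cn_kernel_sqr m :
  mu.-integrable `[0, m%:R * tau[ (EFin \o (fun s => cn_kernel tau mu0 m s ^+ 2)).
Proof.
have [B HB] := cn_kernel_bounded m.
apply: (@integrable_bounded_fun _ _ _ mu _ _ (B ^+ 2)) => //.
- rewrite [X in (X < _)%E]lebesgue_measure_itv/=; case: ifPn => // _.
  by rewrite -EFinB ltry.
- by apply: measurable_funX; exact: measurable_cn_kernel.
- move=> s; rewrite /= in_itv/= => /andP[_ /HB H].
  by rewrite normrX lerXn2r// ?nnegrE// (le_trans _ H).
Qed.

Lemma integrable_cn_kernel_sqr_cell m l : (l < m)%N ->
  mu.-integrable (cell tau l) (EFin \o (fun s => cn_kernel tau mu0 m s ^+ 2)).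
Proof.
move=> lm; apply: integrableS (integrable_cn_kernel_sqr m) => //.
exact: cell_sub.
Qed.

Lemma integrable_cst_cell l (c : R) : mu.-integrable (cell tau l) (EFin \o cst c).
Proof.
apply: (@integrable_bounded_fun _ _ _ mu _ _ `|c|) => //.
by rewrite [X in (X < _)%E]lebesgue_measure_cell ltry.
Qed.

Lemma Rintegral_cst_cell l (c : R) : \int[mu]_(s in cell tau l) c = tau * c.
Proof.
rewrite Rintegral_cst ?[X in fine X]lebesgue_measure_cell 1?mulrC//.
Qed.

(** Splits the remaining time m tau - s into m - l - 1 whole steps and a fraction l + 1 - s/tau of a
    step, the form required by [kernel_diff_sqr_le]. *)
Lemma cn_kernel_cell m l s : (l < m)%N -> cell tau l s ->
  cn_kernel tau mu0 m s = cn_gain x * cn_ratio x ^+ (m - l.+1) -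
    expR (- (((m - l.+1)%:R + (l.+1%:R - s / tau)) * x)).
Proof.
move=> lm ls; rewrite /cn_kernel (cn_steps_cell lm ls); congr (_ - expR (- _)).
by rewrite natrB// /x; field; rewrite gt_eqF.
Qed.

(** Cell by cell the kernel squared is at most 74 x^2 q^j, and the geometric sum of the q^j is at
    most (1 + x)/x <= 2/x, whence 148 = 74 * 2 and one surviving power of x. *)
Lemma cn_kernel_integral_small m : x <= 1 ->
  \int[mu]_(s in `[0, m%:R * tau[) cn_kernel tau mu0 m s ^+ 2 <= 148 * tau * x.
Proof.
move=> x1; have x0 : 0 < x by exact: mulr_gt0.
rewrite Rintegral_cells; last exact: integrable_cn_kernel_sqr.
apply: (@le_trans _ _ (\sum_(l < m) tau * (74 * x ^+ 2 * (1 + x)^-1 ^+ (m - l.+1)))).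
  apply: ler_sum => l _; rewrite -(Rintegral_cst_cell l).
  apply: le_Rintegral => //.
  - exact: integrable_cn_kernel_sqr_cell.
  - exact: integrable_cst_cell.
  - move=> s ls; rewrite (cn_kernel_cell (ltn_ord l) ls).
    apply: kernel_diff_sqr_le => //.
    move: ls; rewrite /cell/= in_itv/= -ler_pdivlMr// -ltr_pdivrMr// => /andP[a b].
    by rewrite -natr1 in b *; apply/andP; split; lra.
rewrite -mulr_sumr -mulr_sumr.
have -> : \sum_(l < m) (1 + x)^-1 ^+ (m - l.+1) = \sum_(j < m) (1 + x)^-1 ^+ j.
  by rewrite [RHS](reindex_inj rev_ord_inj).
have q1 : 0 <= (1 + x)^-1 < 1.
  by apply/andP; split; [rewrite invr_ge0; lra|rewrite invf_lt1; lra].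
have := sum_geometric_le m q1.
have -> : (1 - (1 + x)^-1)^-1 = (1 + x) / x by field; rewrite !gt_eqF//; lra.
rewrite ler_pdivlMr//; set S := \sum_(_ < _) _ => SH.
have -> : tau * (74 * x ^+ 2 * S) = 74 * tau * x * (S * x) by ring.
have -> : 148 * tau * x = 74 * tau * x * 2 by ring.
apply: ler_wpM2l; last by lra.
by rewrite mulr_ge0 ?ltW// mulr_gt0.
Qed.

Lemma decay_sqr_integral_le m : (0 < m)%N ->
  \int[mu]_(s in `[0, m%:R * tau[) expR (- (mu0 * (m%:R * tau - s))) ^+ 2
    <= tau / (2 * x).
Proof.
move=> m0; have x0 : 0 < x by exact: mulr_gt0.
have tm : 0 < m%:R * tau by rewrite mulr_gt0 ?ltr0n.
pose e s := expR ((- (2 * mu0)) * (m%:R * tau - s)).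
have ce : continuous e by exact: continuous_expR_affine.
rewrite (@eq_Rintegral _ _ _ mu _ e); last first.
  by move=> s _; rewrite -expRM_natl /e; congr expR; ring.
rewrite -Rintegral_itv_obnd_cbnd; last exact: continuous_integrable_oo.
have dF (s : R) : is_derive s 1 (fun s => (2 * mu0)^-1 * e s) (e s).
  have d1 : is_derive s 1 (fun s : R => (- (2 * mu0)) * (m%:R * tau - s)) (2 * mu0).
    by apply: is_derive_eq; rewrite /GRing.scale/=; ring.
  have d2 := @is_derive1_comp R expR _ s _ _ _ d1.
  have d3 := is_deriveZ (2 * mu0)^-1 (d2 _ (is_derive_expR _)).
  apply: (is_derive_eq d3); rewrite /GRing.scale/= /e; field.
  by rewrite gt_eqF.
rewrite (Rintegral_FTC tm ce dF) /e subrr mulr0 expR0 mulr1.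
have -> : tau / (2 * x) = (2 * mu0)^-1 by rewrite /x; field; rewrite !gt_eqF.
by rewrite gerBl mulr_ge0 ?expR_ge0// invr_ge0 mulr_ge0// ltW.
Qed.

(** No cancellation is sought: (A - B)^2 <= 2 A^2 + 2 B^2, and each square integrates to at most
    tau/(2x). For the discrete part this rests on 1 - r^2 = 2 x b^2, which offsets the slow decay of
    r^(2j) when r is close to -1. *)
Lemma cn_kernel_integral_large m : (0 < m)%N -> 
  \int[mu]_(s in `[0, m%:R * tau[) cn_kernel tau mu0 m s ^+ 2 <= 2 * (tau / x).
Proof.
move=> m0; have x0 : 0 < x by exact: mulr_gt0.
pose e s := expR (- (mu0 * (m%:R * tau - s))) ^+ 2.
have ce : continuous e by move=> s; apply: cvgM; exact: continuous_decay.
have ie : mu.-integrable `[0, m%:R * tau[ (EFin \o e).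
  apply: (@integrableS _ _ _ mu `[0, m%:R * tau]) => //.
    exact: subset_itv_co_cc.
  apply: continuous_compact_integrable; first exact: segment_compact.
  exact: continuous_subspaceT.
have iec l : (l < m)%N -> mu.-integrable (cell tau l) (EFin \o e).
  move=> lm; apply: integrableS ie => //.
  exact: cell_sub.
rewrite Rintegral_cells; last exact: integrable_cn_kernel_sqr.
apply: (@le_trans _ _ (\sum_(l < m)
    (tau * (2 * (cn_gain x * cn_ratio x ^+ (m - l.+1)) ^+ 2) +
     2 * \int[mu]_(s in cell tau l) e s))).
  apply: ler_sum => l _.
  rewrite -(Rintegral_cst_cell l) -RintegralZl//; last exact: iec.
  rewrite -RintegralD//; last 2 first.
  - exact: integrable_cst_cell.
  - by apply: integrableRZ => //; exact: iec.
  apply: le_Rintegral => //.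
  - exact: integrable_cn_kernel_sqr_cell.
  - apply: integrableRD => //; first exact: integrable_cst_cell.
    by apply: integrableRZ => //; exact: iec.
  - move=> s ls; rewrite /cn_kernel (cn_steps_cell (ltn_ord l) ls) /e.
    set A := cn_gain _ * _; set B := expR _.
    by have := sqr_ge0 (A + B); nra.
rewrite big_split/= -2!mulr_sumr -mulr_sumr -Rintegral_cells//.
have De := decay_sqr_integral_le m0.
have a0 : 0 < 1 + x / 2 by lra.
have r2 : 0 <= cn_ratio x ^+ 2 < 1.
  rewrite sqr_ge0/= /cn_ratio expr_div_n ltr_pdivrMr ?exprn_gt0// mul1r.
  by rewrite -subr_gt0 (_ : _ - _ = 2 * x) ?mulr_gt0//; field.
have G := sum_geometric_le m r2.
have E : \sum_(l < m) (cn_gain x * cn_ratio x ^+ (m - l.+1)) ^+ 2 =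
    cn_gain x ^+ 2 * \sum_(j < m) (cn_ratio x ^+ 2) ^+ j.
  rewrite mulr_sumr [RHS](reindex_inj rev_ord_inj); apply: eq_bigr => j _ /=.
  by rewrite exprMn -!exprM mulnC.
rewrite E.
have G2 : cn_gain x ^+ 2 * \sum_(j < m) (cn_ratio x ^+ 2) ^+ j <= (2 * x)^-1.
  apply: (le_trans (ler_wpM2l (sqr_ge0 _) G)).
  rewrite le_eqVlt; apply/orP; left; apply/eqP.
  have -> : 1 - cn_ratio x ^+ 2 = 2 * x * cn_gain x ^+ 2.
    by rewrite /cn_gain /cn_ratio; field; lra.
  have g0 : 0 < cn_gain x by rewrite invr_gt0.
  by move: g0; set g := cn_gain x => g0; field; rewrite !gt_eqF.
have -> : 2 * (tau / x) = tau * (2 * (2 * x)^-1) + 2 * (tau / (2 * x)).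
  by field; rewrite gt_eqF.
by rewrite lerD// ler_wpM2l// ?(ltW tau_gt0)// ler_wpM2l.
Qed.

(** One formula for both regimes. If x <= 1 then (1 + y)^2 <= 4, so the constant is 148 * 4 = 592;
    if x > 1 then (1 + y)^2 <= 4 y^2 <= 4x, so 2/x <= 8/(1 + y)^2. *)
Lemma cn_kernel_integral_le m (y : R) : (0 < m)%N -> 0 <= y -> y ^+ 4 = x ->
  \int[mu]_(s in `[0, m%:R * tau[) cn_kernel tau mu0 m s ^+ 2
    <= 592 * tau * ((1 + y) ^+ 2)^-1.
Proof.
move=> m0 y0 yx; have x0 : 0 < x by exact: mulr_gt0.
have y1 : 0 < (1 + y) ^+ 2 by rewrite exprn_gt0//; lra.
have [x1|x1] := leP x 1.
  apply: (le_trans (cn_kernel_integral_small _ x1)).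
  have yle1 : y <= 1.
    rewrite leNgt; apply/negP => yg1.
    have : 1 < y ^+ 4 by rewrite exprn_egt1.
    by rewrite yx ltNge x1.
  rewrite ler_pdivlMr// [leRHS](_ : _ = 148 * tau * 4); last by ring.
  have -> : 148 * tau * x * (1 + y) ^+ 2 = 148 * tau * (x * (1 + y) ^+ 2) by ring.
  apply: ler_wpM2l; first by rewrite mulr_ge0// ltW.
  have x4 : x * (1 + y) ^+ 2 <= 1 * (1 + 1) ^+ 2.
    apply: ler_pM => //; [exact: ltW|exact: sqr_ge0|].
    by rewrite lerXn2r ?nnegrE//; lra.
  by apply: (le_trans x4); lra.
apply: (le_trans (cn_kernel_integral_large m0)).
have yge1 : 1 <= y.
  rewrite leNgt; apply/negP => yl1.
  by have := exprn_ile1 4 y0 (ltW yl1); rewrite yx leNgt x1.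
have yy : y ^+ 2 <= x by rewrite -yx ler_weXn2l.
have yp : (1 + y) ^+ 2 <= 4 * x.
  apply: (@le_trans _ _ (4 * y ^+ 2)); last by rewrite ler_wpM2l.
  by nra.
have -> : 2 * (tau / x) = 8 * tau * (4 * x)^-1 by field; rewrite gt_eqF.
apply: ler_pM; [by rewrite mulr_ge0// ltW|by rewrite invr_ge0 mulr_ge0// ltW| |].
  by rewrite ler_wpM2r ?ltW//; lra.
by rewrite lef_pV2// posrE mulr_gt0.
Qed.

End fixed_step.

(** The discrete form of integrating (1 + s c)^(-2) over s >= 0. With z = 1 + k c, the new term is
    below 1/(z(z+c)) = 1/(c z) - 1/(c(z+c)), which telescopes from 1/c. *)
Lemma sum_invr_sqr_affine_le (c : R) n : 0 < c ->
  \sum_(1 <= k < n) ((1 + k%:R * c) ^+ 2)^-1 <= c^-1.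
Proof.
move=> c0; suff H k : \sum_(1 <= k < k.+1) ((1 + k%:R * c) ^+ 2)^-1 <=
    c^-1 - (c * (1 + k%:R * c))^-1.
  case: n => [|n]; first by rewrite big_geq// invr_ge0 ltW.
  apply: (le_trans (H n)); rewrite gerBl invr_ge0 mulr_ge0 ?ltW//.
  by rewrite ltr_pwDl// mulr_ge0// ltW.
elim: k => [|k IH].
  by rewrite big_geq// mul0r addr0 mulr1 subrr.
rewrite big_nat_recr//= (le_trans (lerD IH (lexx _)))//.
have a0 : 0 < 1 + k%:R * c by rewrite ltr_pwDl// mulr_ge0// ltW.
have -> : 1 + k.+1%:R * c = (1 + k%:R * c) + c by rewrite -natr1; ring.
set z := 1 + k%:R * c in a0 *.
have zc : 0 < z + c by lra.
rewrite -subr_ge0 (_ : _ - _ = c / (z * (z + c) ^+ 2)).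
  by rewrite divr_ge0 ?(ltW c0)// mulr_ge0 ?sqr_ge0// ltW.
by field; rewrite !gt_eqF.
Qed.

End crank_nicolson_kernel_integral.

(** * Discretized load and mild solution *)

Section indicator_bessel.
Context d (S : measurableType d) (R : realType).
Variable mu : {measure set S -> \bar R}.
Variables (D : set S) (A : nat -> set S) (I : seq nat) (kap : S -> R) (dt : R).
Hypothesis mD : measurable D.
Hypothesis Doo : (mu D < +oo)%E.
Hypothesis mA : forall n, measurable (A n).
Hypothesis uI : uniq I.
Hypothesis Adisj : forall n k s, n \in I -> k \in I -> A n s -> A k s -> n = k.
Hypothesis dt0 : 0 < dt.
Hypothesis Adt : forall n, n \in I -> \int[mu]_(s in D) \1_(A n) s <= dt.
Hypothesis mk : measurable_fun D kap.
Hypothesis bk : exists B : R, forall s, D s -> `|kap s| <= B.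

Lemma indicator_sum_sqr (c : nat -> R) s :
  (\sum_(n <- I) c n * \1_(A n) s) ^+ 2 = \sum_(n <- I) c n ^+ 2 * \1_(A n) s.
Proof.
have [[n nI An]|H] := pselect (exists2 n, n \in I & A n s).
  have out k : (k != n) && (k \in I) -> \1_(A k) s = 0 :> R.
    move=> /andP[/eqP kn kI]; rewrite indicE memNset// => Ak.
    by apply: kn; exact: Adisj kI nI Ak An.
  rewrite (bigD1_seq n)//= [RHS](bigD1_seq n)//=.
  rewrite !big1_seq ?addr0; first by rewrite indicE mem_set// !mulr1.
  - by move=> k /out ->; rewrite mulr0.
  - by move=> k /out ->; rewrite mulr0.
have out k : true && (k \in I) -> \1_(A k) s = 0 :> R.
  by move=> kI; rewrite indicE memNset// => Ak; apply: H; exists k.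
rewrite !big1_seq ?expr0n// => k /out ->; rewrite mulr0//.
Qed.

(** Integrates kap^2 >= 2 Q kap - Q^2, where Q is the step function with the values c_n. The n-th
    term contributes 2 dt c_n^2 minus c_n^2 times the measure of A_n within D. That this measure is
    at most dt suffices, which matters because the final time may cut a noise cell. *)
Lemma indicator_bessel :
  \sum_(n <- I) dt * (dt^-1 * \int[mu]_(s in D) (\1_(A n) s * kap s)) ^+ 2
    <= \int[mu]_(s in D) kap s ^+ 2.
Proof.
have [B kB] := bk.
pose c n := dt^-1 * \int[mu]_(s in D) (\1_(A n) s * kap s).
have m1 n : measurable_fun D (\1_(A n) : S -> R) by exact: measurable_indic.
have b1 n (s : S) : `|\1_(A n) s : R| <= 1.
  by rewrite indicE; case: (_ \in _); rewrite ?normr0 ?normr1.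
have i1 n : mu.-integrable D (EFin \o (\1_(A n) : S -> R)).
  by apply: (@integrable_bounded_fun _ _ _ mu _ _ 1).
have i1k n : mu.-integrable D (EFin \o (fun s => \1_(A n) s * kap s)).
  by apply: (@integrable_mul_bounded _ _ _ mu D _ kap B) => //.
have ikk : mu.-integrable D (EFin \o (fun s => kap s ^+ 2)).
  apply: (@integrable_bounded_fun _ _ _ mu _ _ (B ^+ 2)) => //.
    exact: measurable_funX.
  move=> s Ds; rewrite normrX lerXn2r ?nnegrE ?kB//.
  by rewrite (le_trans _ (kB _ Ds)).
have iterm n : mu.-integrable D (EFin \o (fun s =>
    2 * c n * (\1_(A n) s * kap s) - c n ^+ 2 * \1_(A n) s)).
  by apply: integrableRB => //; apply: integrableRZ.
apply: (@le_trans _ _ (\int[mu]_(s in D) (\sum_(n <- I)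
    (2 * c n * (\1_(A n) s * kap s) - c n ^+ 2 * \1_(A n) s)))); last first.
  apply: le_Rintegral => //; first exact: integrableR_sum.
  move=> s Ds; rewrite sumrB -indicator_sum_sqr.
  set Q := \sum_(n <- I) c n * \1_(A n) s.
  have -> : \sum_(n <- I) 2 * c n * (\1_(A n) s * kap s) = 2 * Q * kap s.
    rewrite /Q mulr_sumr mulr_suml; apply: eq_bigr => n _; ring.
  by have := sqr_ge0 (kap s - Q); nra.
rewrite Rintegral_sum//.
rewrite [leLHS]big_seq_cond [leRHS]big_seq_cond.
apply: ler_sum => n /andP[nI _].
rewrite RintegralB//; [|exact: integrableRZ..].
rewrite !RintegralZl// -/(c n).
have -> : \int[mu]_(s in D) (\1_(A n) s * kap s) = dt * c n.
  by rewrite /c mulVKf// gt_eqF.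
have := ler_wpM2l (sqr_ge0 (c n)) (Adt nI).
by nra.
Qed.

End indicator_bessel.

(** * The load for a fixed outcome *)

Section discrete_load.
Variable R : realType.
Notation mu := (@lebesgue_measure R).
Variables (T : R) (N Mst : nat).
Hypothesis T0 : 0 < T.
Hypothesis N0 : (0 < N)%N.
Variable X : nat -> nat -> R.

Let dt := T / N%:R.
Let dt0 : 0 < dt. Proof. by rewrite divr_gt0 ?ltr0n. Qed.

Lemma grid_cell_cell n : (0 < n)%N -> grid_cell T N n `<=` cell dt n.-1.
Proof.
move=> n0 s; rewrite /grid_cell /cell /grid/= !in_itv/= prednK//.
by move=> /andP[/ltW -> ->].
Qed.

Lemma grid_cell_inj n k (s : R) : (0 < n)%N -> (0 < k)%N ->
  grid_cell T N n s -> grid_cell T N k s -> n = k.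
Proof.
move=> n0 k0 /(grid_cell_cell n0) ns /(grid_cell_cell k0) ks.
by rewrite -(prednK n0) -(prednK k0) (cell_inj dt0 ns ks).
Qed.

Lemma lebesgue_measure_grid_cell n : (0 < n)%N -> mu (grid_cell T N n) = dt%:E.
Proof.
move=> n0; rewrite /grid_cell lebesgue_measure_itv/= lte_fin /grid -/dt.
rewrite ltr_pM2r// ltr_nat prednK// leqnn -EFinB; congr EFin.
by rewrite -mulrBl -[in X in X - _](prednK n0) -natr1; ring.
Qed.

Lemma Rintegral_grid_cell_le (D : set R) n : measurable D -> (0 < n)%N ->
  \int[mu]_(s in D) \1_(grid_cell T N n) s <= dt.
Proof.
move=> mD n0; have mc : measurable (grid_cell T N n) by exact: measurable_itv.
rewrite /Rintegral integral_indic// -[leRHS]/(fine dt%:E).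
rewrite -(lebesgue_measure_grid_cell n0); apply: fine_le.
- rewrite ge0_fin_numE//; apply: (@le_lt_trans _ _ (mu (grid_cell T N n))).
    by apply: le_measure; rewrite ?inE//; exact: measurableI.
  by rewrite [X in (X < _)%E]lebesgue_measure_grid_cell// ltry.
- by rewrite [X in X \is a fin_num]lebesgue_measure_grid_cell.
- by apply: le_measure; rewrite ?inE//; exact: measurableI.
Qed.

(** [What] at one fixed outcome, with the noise increments replaced by arbitrary reals [X n i]. The
    body copies that of [What], so pathwise results apply to it by conversion. *)
Definition load (t x : R) : R :=
  \sum_(1 <= n < N.+1) \1_(grid_cell T N n) t *
    ((T / N%:R)^-1 * \sum_(1 <= i < Mst.+1) X n i * vareps i x).

Definition load_coef (i : nat) (t : R) : R :=
  \sum_(1 <= n < N.+1) \1_(grid_cell T N n) t * ((T / N%:R)^-1 * X n i).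

Lemma loadE t x : load t x = \sum_(1 <= i < Mst.+1) load_coef i t * vareps i x.
Proof.
rewrite /load /load_coef.
under eq_bigr do rewrite !mulr_sumr.
rewrite exchange_big/=; apply: eq_bigr => i _.
by rewrite mulr_suml; apply: eq_bigr => n _; rewrite !mulrA.
Qed.

Lemma measurable_load_coef i D : measurable_fun D (load_coef i).
Proof.
apply: measurable_sum => n; apply: measurable_funM => //.
by apply: measurable_indic; exact: measurable_itv.
Qed.

Lemma load_coef_bounded i : exists B : R, forall t, `|load_coef i t| <= B.
Proof.
exists (\sum_(1 <= n < N.+1) `|(T / N%:R)^-1 * X n i|) => t.
rewrite (le_trans (ler_norm_sum _ _ _))//; apply: ler_sum => n _.
rewrite normrM ler_piMl// indicE.
by case: (_ \in _); rewrite ?normr0 ?normr1.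
Qed.

Lemma integrable_mul_load_coef (D : set R) (f : R -> R) i : measurable D ->
  mu.-integrable D (EFin \o f) ->
  mu.-integrable D (EFin \o (fun s => f s * load_coef i s)).
Proof.
move=> mD iF; have [B HB] := load_coef_bounded i.
apply: (@integrable_mul_bounded _ _ _ mu D f _ B) => //.
exact: measurable_load_coef.
Qed.

Lemma Rintegral_mul_load_coef (D : set R) (f : R -> R) i : measurable D ->
  mu.-integrable D (EFin \o f) ->
  \int[mu]_(s in D) (f s * load_coef i s) =
  \sum_(1 <= n < N.+1) (dt^-1 * \int[mu]_(s in D) (\1_(grid_cell T N n) s * f s)) * X n i.
Proof.
move=> mD iF.
have i1 n : mu.-integrable D (EFin \o (fun s => \1_(grid_cell T N n) s * f s)).
  apply: (@eq_integrableR _ _ _ mu D (fun s => f s * \1_(grid_cell T N n) s)) => //.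
    by move=> s _; rewrite mulrC.
  apply: (@integrable_mul_bounded _ _ _ mu D f _ 1) => //.
    by apply: measurable_indic; exact: measurable_itv.
  by move=> s _; rewrite indicE; case: (_ \in _); rewrite ?normr0 ?normr1.
transitivity (\int[mu]_(s in D) (\sum_(1 <= n < N.+1)
    (dt^-1 * X n i) * (\1_(grid_cell T N n) s * f s))).
  apply: eq_Rintegral => s _; rewrite /load_coef mulr_sumr.
  by apply: eq_bigr => n _; rewrite -/dt; ring.
rewrite Rintegral_sum//; last by move=> n; exact: integrableRZ.
by apply: eq_bigr => n _; rewrite RintegralZl//; ring.
Qed.

Lemma Rintegral_load (D : set R) x : measurable D -> (mu D < +oo)%E ->
  \int[mu]_(s in D) load s x =
  \sum_(1 <= i < Mst.+1) (\int[mu]_(s in D) load_coef i s) * vareps i x.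
Proof.
move=> mD Doo.
have il i : mu.-integrable D (EFin \o load_coef i).
  have [B HB] := load_coef_bounded i.
  apply: (@integrable_bounded_fun _ _ _ mu _ _ B) => //.
  exact: measurable_load_coef.
transitivity (\int[mu]_(s in D) (\sum_(1 <= i < Mst.+1) vareps i x * load_coef i s)).
  by apply: eq_Rintegral => s _; rewrite loadE; apply: eq_bigr => i _; rewrite mulrC.
rewrite Rintegral_sum//; last by move=> i; exact: integrableRZ.
by apply: eq_bigr => i _; rewrite RintegralZl// mulrC.
Qed.

End discrete_load.

(** * The Green function and the mild solution mode by mode *)

Section green_function.
Variable R : realType.
Notation mu := (@lebesgue_measure R).

Lemma expRN_le_inv (z : R) : 0 < z -> expR (- z) <= z^-1.
Proof.
move=> z0; rewrite expRN lef_pV2 ?posrE ?expR_gt0//.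
by apply: le_trans (expR_ge1Dx z); rewrite lerDr.
Qed.

Let gterm (t x y : R) k := expR (- (lambda R k ^+ 4 * t)) * vareps k x * vareps k y.

(** From exp(-z) <= 1/z with z = lambda_k^4 t. The bound degenerates as t tends to 0, which is
    harmless because it serves at one positive t at a time. *)
Lemma green_term_le (t x y : R) k : 0 < t -> (0 < k)%N ->
  `|gterm t x y k| <= (4 / t) * (k%:R ^+ 2)^-1.
Proof.
move=> t0 k0; have k1 : 1 <= k%:R :> R by rewrite ler1n.
have l4 : k%:R ^+ 2 <= lambda R k ^+ 4.
  apply: le_trans (_ : k%:R ^+ 4 <= _); first by rewrite ler_weXn2l.
  by have := lambda_ge_nat R k; move=> H; rewrite lerXn2r ?nnegrE//; lra.
have k2 : 0 < k%:R ^+ 2 :> R by rewrite exprn_gt0//; lra.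
have e1 : expR (- (lambda R k ^+ 4 * t)) <= t^-1 * (k%:R ^+ 2)^-1.
  have l40 : 0 < lambda R k ^+ 4 * t by rewrite mulr_gt0// (lt_le_trans k2).
  rewrite -invfM; apply: (le_trans (expRN_le_inv l40)).
  have A : t * k%:R ^+ 2 <= lambda R k ^+ 4 * t by rewrite [leRHS]mulrC ler_pM2l.
  by rewrite lef_pV2// posrE mulr_gt0.
rewrite /gterm [`|_ * vareps k y|]normrM [`|_ * vareps k x|]normrM (ger0_norm (expR_ge0 _)).
have -> : 4 / t * (k%:R ^+ 2)^-1 = t^-1 * (k%:R ^+ 2)^-1 * 2 * 2 by ring.
apply: ler_pM; [|exact: normr_ge0| |exact: vareps_le2].
  by rewrite mulr_ge0 ?expR_ge0.
by apply: ler_pM => //; exact: vareps_le2.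
Qed.

Lemma green_abs_sum_le (t x y : R) n : 0 < t ->
  \sum_(1 <= k < n) `|gterm t x y k| <= 8 / t.
Proof.
move=> t0; apply: (@le_trans _ _ (\sum_(1 <= k < n) (4 / t) * (k%:R ^+ 2)^-1)).
  by apply: ler_sum_nat => k /andP[k0 _]; exact: green_term_le.
rewrite -mulr_sumr; have -> : 8 / t = 4 / t * 2 by ring.
by rewrite ler_wpM2l ?sum_invr_sqr_le// divr_ge0// ltW.
Qed.

Lemma cvg_green (t x y : R) : 0 < t ->
  \sum_(1 <= k < n) gterm t x y k @[n --> \oo] --> green t x y.
Proof.
by move=> t0; apply: is_cvg_sum1_abs_bounded => n; exact: green_abs_sum_le.
Qed.

Lemma green_sum_le (t x y : R) n : 0 < t ->
  `|\sum_(1 <= k < n) gterm t x y k| <= 8 / t.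
Proof.
by move=> t0; rewrite (le_trans (ler_norm_sum _ _ _))//; exact: green_abs_sum_le.
Qed.

Lemma inL2_green_sum (t x : R) n :
  inL2 (fun y => \sum_(1 <= k < n) gterm t x y k).
Proof. by apply: inL2_sum => k; exact/inL2Z/inL2_vareps. Qed.

Lemma inL2_green (t x : R) : 0 < t -> inL2 (green t x).
Proof.
move=> t0; apply: (@bounded_inL2 _ _ (8 / t)).
  apply: (@measurable_fun_cvg _ _ _ _ (fun n y => \sum_(1 <= k < n) gterm t x y k)).
    by move=> n; exact: inL2_measurable (inL2_green_sum t x n).
  by move=> y _; exact: cvg_green.
move=> y _.
have C : `|\sum_(1 <= k < n) gterm t x y k| @[n --> \oo] --> `|green t x y|.
  by apply: cvg_norm; exact: cvg_green.
apply: (cvgr_to_le C).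
by near=> n; exact: green_sum_le.
Unshelve. all: by end_near. Qed.

Lemma L2_inner_green (t x : R) i : 0 < t -> (0 < i)%N ->
  L2_inner (green t x) (vareps i) = expR (- (lambda R i ^+ 4 * t)) * vareps i x.
Proof.
move=> t0 i0; have mD := @measurable_dom R.
have hi := @inL2_vareps R i.
have C : L2_inner (fun y => \sum_(1 <= k < n) gterm t x y k) (vareps i)
    @[n --> \oo] --> L2_inner (green t x) (vareps i).
  apply: (@Rintegral_dominated _ _ _ mu _ _ _ (fun=> 8 / t * 2)) => //.
  - by move=> n; apply: measurable_funM; apply: inL2_measurable => //; exact: inL2_green_sum.
  - by apply: measurable_funM; apply: inL2_measurable => //; exact: inL2_green.
  - apply: (@integrable_bounded_fun _ _ _ mu _ _ `|8 / t * 2|) => //.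
    by rewrite [X in (X < _)%E]lebesgue_measure_dom ltry.
  - by move=> y _; apply: cvgM; [exact: cvg_green|exact: cvg_cst].
  - move=> n y _; rewrite normrM ler_pM ?vareps_le2//; exact: green_sum_le.
apply: (cvg_unique (@Rhausdorff R) C).
apply: cvg_near_cst; near=> n.
have ni : (i < n)%N by near: n; exact: nbhs_infty_gt.
have hk k : inL2 (fun y => gterm t x y k) by exact/inL2Z/inL2_vareps.
rewrite L2_inner_suml// (bigD1_seq i)/= ?mem_index_iota ?i0 ?iota_uniq//.
rewrite L2_innerZl ?L2_inner_vareps// ?eqxx ?mulr1; [|exact: inL2_vareps..].
rewrite big_nat_cond big1 ?addr0// => j /andP[/andP[j1 _] ji].
by rewrite L2_innerZl ?L2_inner_vareps ?(negbTE ji) ?mulr0//; exact: inL2_vareps.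
Unshelve. all: by end_near. Qed.

Section mild_solution.
Variables (T : R) (N Mst : nat).
Variable X : nat -> nat -> R.

(** The space integral is evaluated separately for each s < t, where the Green series at the
    positive time t - s may be integrated termwise. The load has finitely many modes, so only a
    finite sum is exchanged with the time integral, and the singularity at s = t is never met. *)
Lemma mild_solution_load (t x : R) :
  \int[mu]_(s in `]0, t[) \int[mu]_(y in dom R)
      (green (t - s) x y * load T N Mst X s y) =
  \sum_(1 <= i < Mst.+1) vareps i x *
    \int[mu]_(s in `[0, t[) (expR (- (lambda R i ^+ 4 * (t - s))) * load_coef T N X i s).
Proof.
have ce i : continuous (fun s : R => expR (- (lambda R i ^+ 4 * (t - s)))).
  have := @continuous_expR_affine R (- lambda R i ^+ 4) t.
  by under eq_fun do rewrite mulNr.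
have ie i : mu.-integrable `[0, t[ (EFin \o (fun s : R =>
    expR (- (lambda R i ^+ 4 * (t - s))) * load_coef T N X i s)).
  apply: integrable_mul_load_coef => //.
  apply: (@integrableS _ _ _ mu `[0, t]) => //; first exact: subset_itv_co_cc.
  apply: continuous_compact_integrable; first exact: segment_compact.
  exact: continuous_subspaceT.
have ieo i : mu.-integrable `]0, t[ (EFin \o (fun s : R =>
    expR (- (lambda R i ^+ 4 * (t - s))) * load_coef T N X i s)).
  by apply: integrableS (ie i) => //; exact: subset_itv_oo_co.
under [RHS]eq_bigr do rewrite -Rintegral_itv_obnd_cbnd// -RintegralZl//.
rewrite -Rintegral_sum//; last by move=> i; exact: integrableRZ.
apply: eq_Rintegral => s; rewrite inE/= in_itv/= => /andP[s0 st].
have ts : 0 < t - s by rewrite subr_gt0.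
transitivity (L2_inner (fun y => \sum_(1 <= i < Mst.+1) load_coef T N X i s * vareps i y)
    (green (t - s) x)).
  by apply: eq_Rintegral => y _; rewrite loadE mulrC.
rewrite L2_inner_suml; [|by move=> i; exact/inL2Z/inL2_vareps|exact: inL2_green].
apply: eq_big_nat => i /andP[i0 _].
rewrite L2_innerZl; [|exact: inL2_vareps|exact: inL2_green].
by rewrite L2_innerC L2_inner_green//; ring.
Qed.

End mild_solution.
End green_function.

(** * Pathwise diagonalization of the scheme *)

Section spectral_solution.
Variable R : realType.
Notation mu := (@lebesgue_measure R).

Lemma dotH4_rapid (g : R -> R) : dotH4 g -> exists K : R, forall n,
  \sum_(1 <= k < n) lambda R k ^+ 8 * L2_inner g (vareps k) ^+ 2 <= K.
Proof.
move=> [_ goo]; exists (fine (\sum_(1 <= k <oo)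
    ((lambda R k ^+ 8 * (L2_inner g (vareps k)) ^+ 2)%:E))%E) => n.
have t0 k : (0 <= (lambda R k ^+ 8 * (L2_inner g (vareps k)) ^+ 2)%:E)%E.
  by rewrite lee_fin mulr_ge0 ?sqr_ge0 ?exprn_even_ge0.
rewrite -lee_fin fineK; last first.
  by rewrite ge0_fin_numE//; apply: nneseries_ge0 => k _ _; exact: t0.
by rewrite -sumEFin; apply: nneseries_lim_ge => k _ _; exact: t0.
Qed.

Lemma rapidD (f g : R -> R) (K L : R) : inL2 f -> inL2 g ->
  (forall n, \sum_(1 <= k < n) lambda R k ^+ 8 * L2_inner f (vareps k) ^+ 2 <= K) ->
  (forall n, \sum_(1 <= k < n) lambda R k ^+ 8 * L2_inner g (vareps k) ^+ 2 <= L) ->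
  forall n, \sum_(1 <= k < n)
    lambda R k ^+ 8 * L2_inner (fun x => f x + g x) (vareps k) ^+ 2 <= 2 * K + 2 * L.
Proof.
move=> hf hg fK gL n.
apply: le_trans (lerD (ler_wpM2l (ler0n R 2) (fK n)) (ler_wpM2l (ler0n R 2) (gL n))).
rewrite !mulr_sumr -big_split/=; apply: ler_sum => k _.
rewrite L2_innerDl//; last exact: inL2_vareps.
set a := L2_inner f _; set b := L2_inner g _; set l := lambda R k ^+ 8.
have l0 : 0 <= l by exact: exprn_even_ge0.
have -> : 2 * (l * a ^+ 2) + 2 * (l * b ^+ 2) = l * (2 * a ^+ 2 + 2 * b ^+ 2) by ring.
by apply: ler_wpM2l => //; have := sqr_ge0 (a - b); nra.
Qed.

Lemma L2_norm_sqrE (f : R -> R) : inL2 f -> (L2_norm f ^+ 2)%E = (L2_inner f f)%:E.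
Proof.
move=> hf; have hi := inL2_sqr_integrable hf.
have E : (\int[mu]_(x in dom R) ((f x) ^+ 2)%:E)%E = (L2_inner f f)%:E.
  rewrite /L2_inner (@eq_Rintegral _ _ _ mu _ (fun x => f x ^+ 2)); last first.
    by move=> x _; rewrite expr2.
  by rewrite /Rintegral fineK//; apply: integrable_fin_num => //; exact: measurable_dom.
rewrite /L2_norm E.
have f0 : 0 <= L2_inner f f by apply: Rintegral_ge0 => x _; rewrite -expr2 sqr_ge0.
by rewrite poweR_EFin powR12_sqrt// -EFin_expe sqr_sqrtr.
Qed.

Variables (T : R) (N Mst M : nat).
Hypothesis T0 : 0 < T.
Hypothesis N0 : (0 < N)%N.
Hypothesis M0 : (0 < M)%N.
Variable X : nat -> nat -> R.
Variable V : nat -> R -> R.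
Hypothesis V0 : forall x, V 0 x = 0.
Hypothesis VS : forall m, (1 <= m <= M)%N -> dotH4 (V m) /\
  CN_step (load T N Mst X) (grid T M m.-1) (grid T M m) (V m.-1) (V m).

Let tau := T / M%:R.
Let tau0 : 0 < tau. Proof. by rewrite divr_gt0 ?ltr0n. Qed.
Let lam4 i := lambda R i ^+ 4.
Let lc := load_coef T N X.

(** The recursion v -> r v + b J unrolled from zero: the load on a cell is multiplied by the gain
    once, and by the ratio once for every later step. *)
Definition cn_coef (m i : nat) : R :=
  \int[mu]_(s in `[0, m%:R * tau[) (cn_steps tau (lam4 i * tau) m s * lc i s).

Lemma lambda_gt0 i : (0 < i)%N -> 0 < lambda R i.
Proof. by move=> i0; rewrite mulr_gt0 ?pi_gt0 ?ltr0n. Qed.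

Lemma cn_steps_bounded (x : R) m : exists B : R, forall s, `|cn_steps tau x m s| <= B.
Proof.
exists (\sum_(l < m) `|cn_gain x * cn_ratio x ^+ (m - l.+1)|) => s.
rewrite (le_trans (ler_norm_sum _ _ _))//; apply: ler_sum => l _.
rewrite normrM ler_piMr// indicE.
by case: (_ \in _); rewrite ?normr0 ?normr1.
Qed.

Lemma lebesgue_measure_co_lty (a b : R) : (mu `[a, b[ < +oo)%E.
Proof.
by rewrite lebesgue_measure_itv/=; case: ifPn => // _; rewrite -EFinB ltry.
Qed.

Lemma integrable_load_coef (a b : R) i :
  mu.-integrable `[a, b[ (EFin \o lc i).
Proof.
have [B HB] := load_coef_bounded T N X i.
apply: (@integrable_bounded_fun _ _ _ mu _ _ B) => //.
  exact: lebesgue_measure_co_lty.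
exact: measurable_load_coef.
Qed.

Lemma integrable_cn_steps_load (mu0 : R) m (a b : R) i :
  mu.-integrable `[a, b[ (EFin \o (fun s => cn_steps tau (mu0 * tau) m s * lc i s)).
Proof.
apply: integrable_mul_load_coef => //.
have [B HB] := cn_steps_bounded (mu0 * tau) m.
apply: (@integrable_bounded_fun _ _ _ mu _ _ B) => //.
  exact: lebesgue_measure_co_lty.
exact: measurable_cn_steps.
Qed.

Lemma cn_coefS m i : cn_coef m.+1 i =
  cn_ratio (lam4 i * tau) * cn_coef m i +
  cn_gain (lam4 i * tau) * \int[mu]_(s in cell tau m) lc i s.
Proof.
rewrite /cn_coef; set x := lam4 i * tau.
rewrite !(Rintegral_cells tau0); [|exact: integrable_cn_steps_load..].
rewrite big_ord_recr/=; congr (_ + _).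
  rewrite mulr_sumr; apply: eq_bigr => l _.
  rewrite -RintegralZl//; [|exact: measurable_itv|exact: integrable_cn_steps_load].
  apply: eq_Rintegral => s; rewrite inE => ls.
  rewrite (@cn_steps_cell R tau (lam4 i) tau0 m.+1 l s (ltnW (ltn_ord l)) ls).
  rewrite (@cn_steps_cell R tau (lam4 i) tau0 m l s (ltn_ord l) ls) subSn// exprS; ring.
rewrite -RintegralZl//; [|exact: measurable_itv|exact: integrable_load_coef].
apply: eq_Rintegral => s; rewrite inE => ls.
by rewrite (@cn_steps_cell R tau (lam4 i) tau0 m.+1 m s (ltnSn m) ls) subnn expr0 mulr1.
Qed.

(** Testing the step against [vareps k] gives (1 + x/2) v1 = (1 - x/2) v0 + J, with J = 0 beyond the
    last mode of the load. The summability bound is part of the induction because the weak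
    derivative is that of the sum V (m+1) + V m, to which [weak_deriv4_coef] must apply. *)
Lemma spectral_coef m : (m <= M)%N -> [/\ inL2 (V m),
  exists K : R, forall n,
    \sum_(1 <= k < n) lambda R k ^+ 8 * L2_inner (V m) (vareps k) ^+ 2 <= K &
  forall k, (1 <= k)%N ->
    L2_inner (V m) (vareps k) = if (k < Mst.+1)%N then cn_coef m k else 0].
Proof.
elim: m => [_|m IH mM].
  have -> : V 0 = fun=> 0 by apply/funext.
  split; first exact: inL2_0.
    exists 0 => n; rewrite big1// => k _.
    by rewrite L2_inner0l expr0n mulr0.
  move=> k _; rewrite L2_inner0l /cn_coef mul0r set_itvco0 Rintegral_set0.
  by case: ifP.
have [hV [K VK] VC] := IH (ltnW mM).
have [dV [h [wh E]]] : dotH4 (V m.+1) /\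
  CN_step (load T N Mst X) (grid T M m) (grid T M m.+1) (V m) (V m.+1) by exact: (VS (m := m.+1)).
have hV1 : inL2 (V m.+1) by case: dV.
have [L VL] := dotH4_rapid dV.
split=> //; first by exists L.
move=> k k1; have hk := @inL2_vareps R k.
have hs : inL2 (fun x => V m.+1 x + V m x) by exact: inL2D.
have hd : inL2 (fun x => V m.+1 x - V m x) by exact: inL2B.
have hh : inL2 h by case: wh.
have hc := weak_deriv4_coef hs (rapidD hV1 hV VL VK) wh k1.
rewrite L2_innerDl// in hc.
set J := fun i => \int[mu]_(s in cell tau m) lc i s.
pose F x := \sum_(1 <= i < Mst.+1) J i * vareps i x.
have hF : inL2 F by apply: inL2_sum => i; exact/inL2Z/inL2_vareps.
have hl : inL2 (fun x => V m.+1 x - V m x + tau / 2 * h x).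
  by apply: inL2D => //; exact: inL2Z.
have EF : {ae mu, forall x, dom R x -> V m.+1 x - V m x + tau / 2 * h x = F x}.
  apply: filterS E; first exact: (ae_filter_ringOfSetsType mu).
  move=> x + Dx => /(_ Dx).
  have -> : grid T M m.+1 - grid T M m = tau by rewrite /grid -/tau -natr1; ring.
  move=> ->; rewrite Rintegral_load//; last first.
    by rewrite [X in (X < _)%E]lebesgue_measure_itv/=; case: ifPn => // _; rewrite -EFinB ltry.
  apply: eq_bigr => i _; congr (_ * _).
  rewrite Rintegral_itv_obnd_cbnd//.
  apply: (@integrableS _ _ _ mu (cell tau m)) => //.
  - exact: measurable_itv.
  - exact: subset_itv_oo_co.
  - exact: integrable_load_coef.
have Fk : L2_inner F (vareps k) = if (k < Mst.+1)%N then J k else 0.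
  rewrite L2_inner_suml//; last by move=> i; exact/inL2Z/inL2_vareps.
  case: ifPn => [kM|].
    rewrite (bigD1_seq k)/= ?mem_index_iota ?k1 ?iota_uniq//.
    rewrite L2_innerZl ?L2_inner_vareps// ?eqxx ?mulr1//.
    rewrite big_nat_cond big1 ?addr0// => j /andP[/andP[j1 _] jk].
    by rewrite L2_innerZl ?L2_inner_vareps ?(negbTE jk) ?mulr0//; exact: inL2_vareps.
  rewrite -leqNgt => Mk; rewrite big_nat_cond big1// => j /andP[/andP[j1 jM] _].
  rewrite L2_innerZl ?L2_inner_vareps//; last exact: inL2_vareps.
  by rewrite ltn_eqF ?mulr0// (leq_trans jM).
have := ae_eq_L2_inner hl hF hk EF.
rewrite L2_innerDl//; last exact: inL2Z.
rewrite L2_innerBl// L2_innerZl// hc Fk VC//.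
have l0 : 0 < lam4 k by rewrite exprn_gt0// lambda_gt0.
have x0 : 0 < 1 + lam4 k * tau / 2 by rewrite addr_gt0// divr_gt0// mulr_gt0.
rewrite -/(lam4 k); set v1 := L2_inner (V m.+1) _.
move=> H; apply: (mulIf (lt0r_neq0 x0)).
case: ifPn H => _ H.
  transitivity ((1 - lam4 k * tau / 2) * cn_coef m k + J k); first by lra.
  rewrite cn_coefS -/(J k) /cn_ratio /cn_gain; move: x0.
  by set z := lam4 k * tau => x0; field; lra.
by lra.
Qed.

Lemma spectral_expansion m : (m <= M)%N ->
  {ae mu, forall x, dom R x -> V m x = \sum_(1 <= i < Mst.+1) cn_coef m i * vareps i x}.
Proof.
move=> mM; have [hV _ VC] := spectral_coef mM.
apply: inL2_eq_of_coef => //.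
  by apply: inL2_sum => i; exact/inL2Z/inL2_vareps.
move=> k k1; rewrite VC// L2_inner_suml; [|by move=> i; exact/inL2Z/inL2_vareps|exact: inL2_vareps].
case: ifPn => [kM|].
  rewrite (bigD1_seq k)/= ?mem_index_iota ?k1 ?iota_uniq//.
  rewrite L2_innerZl ?L2_inner_vareps// ?eqxx ?mulr1; [|exact: inL2_vareps..].
  rewrite big_nat_cond big1 ?addr0// => j /andP[/andP[j1 _] jk].
  by rewrite L2_innerZl ?L2_inner_vareps ?(negbTE jk) ?mulr0//; exact: inL2_vareps.
rewrite -leqNgt => Mk; rewrite big_nat_cond big1// => j /andP[/andP[j1 jM] _].
rewrite L2_innerZl ?L2_inner_vareps//; [|exact: inL2_vareps..].
by rewrite ltn_eqF ?mulr0// (leq_trans jM).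
Qed.

(** The weight with which the increment [X n i] enters the error at time m tau: the kernel
    integrated over the part of the noise cell before that time, divided by the full cell length. *)
Definition kernel_coef (m i n : nat) : R :=
  (T / N%:R)^-1 * \int[mu]_(s in `[0, m%:R * tau[)
    (\1_(grid_cell T N n) s * cn_kernel tau (lam4 i) m s).

Lemma integrable_cn_kernel i m : (0 < i)%N ->
  mu.-integrable `[0, m%:R * tau[ (EFin \o cn_kernel tau (lam4 i) m).
Proof.
move=> i0; have l0 : 0 < lam4 i by rewrite exprn_gt0// lambda_gt0.
have [B HB] := cn_kernel_bounded tau l0 m.
apply: (@integrable_bounded_fun _ _ _ mu _ _ B) => //.
- exact: lebesgue_measure_co_lty.
- exact: measurable_cn_kernel.
- by move=> s; rewrite /= in_itv/= => /andP[_ /HB].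
Qed.

(** Only modes up to [Mst] occur: in [V m] for almost every x, by completeness, and in the mild
    solution at every x. The squared norm is thus a finite Parseval sum, and each coefficient
    difference integrates [cn_kernel] against a load that is constant on the noise cells. *)
Lemma error_L2_norm_sqr m : (m <= M)%N ->
  (L2_norm (fun x => (V m x - \int[mu]_(s in `]0, grid T M m[)
      \int[mu]_(y in dom R) (green (grid T M m - s) x y * load T N Mst X s y))%R) ^+ 2)%E =
  (\sum_(1 <= i < Mst.+1) (\sum_(1 <= n < N.+1) kernel_coef m i n * X n i) ^+ 2)%:E.
Proof.
move=> mM; have [hV _ _] := spectral_coef mM.
pose e i := \sum_(1 <= n < N.+1) kernel_coef m i n * X n i.
pose Q x := \sum_(1 <= i < Mst.+1) vareps i x *
    \int[mu]_(s in `[0, grid T M m[)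
      (expR (- (lambda R i ^+ 4 * (grid T M m - s))) * lc i s).
have QE : (fun x => V m x - \int[mu]_(s in `]0, grid T M m[)
      \int[mu]_(y in dom R) (green (grid T M m - s) x y * load T N Mst X s y)) =
    (fun x => V m x - Q x).
  by apply/funext => x; rewrite mild_solution_load.
rewrite QE.
pose S x := \sum_(1 <= i < Mst.+1) e i * vareps i x.
have hS : inL2 S by apply: inL2_sum => i; exact/inL2Z/inL2_vareps.
have hQ : inL2 Q.
  apply: inL2_sum => i; under eq_fun do rewrite mulrC.
  exact/inL2Z/inL2_vareps.
have eE i : (0 < i)%N -> e i = cn_coef m i - \int[mu]_(s in `[0, grid T M m[)
      (expR (- (lambda R i ^+ 4 * (grid T M m - s))) * lc i s).
  move=> i0; rewrite /e /kernel_coef -Rintegral_mul_load_coef//; last exact: integrable_cn_kernel.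
  have ie : mu.-integrable `[0, m%:R * tau[
      (EFin \o (fun s => expR (- (lam4 i * (m%:R * tau - s))) * lc i s)).
    apply: integrable_mul_load_coef => //.
    apply: (@integrableS _ _ _ mu `[0, m%:R * tau]) => //; first exact: subset_itv_co_cc.
    apply: continuous_compact_integrable; first exact: segment_compact.
    exact/continuous_subspaceT/continuous_decay.
  rewrite /cn_coef -RintegralB//; last exact: integrable_cn_steps_load.
  by apply: eq_Rintegral => s _; rewrite /cn_kernel mulrBl.
have VSe : {ae mu, forall x, dom R x -> V m x - Q x = S x}.
  apply: filterS (spectral_expansion mM); first exact: (ae_filter_ringOfSetsType mu).
  move=> x + Dx => /(_ Dx) ->; rewrite /Q /S -sumrB; apply: eq_big_nat => i /andP[i0 _].
  by rewrite eE//; ring.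
have hVQ : inL2 (fun x => V m x - Q x) by exact: inL2B.
rewrite L2_norm_sqrE//; congr EFin.
rewrite (ae_eq_L2_inner hVQ hS hVQ VSe) L2_innerC (ae_eq_L2_inner hVQ hS hS VSe).
rewrite L2_inner_suml//; last by move=> i; exact/inL2Z/inL2_vareps.
apply: eq_big_nat => i /andP[i1 iM].
rewrite L2_innerZl//; last exact: inL2_vareps.
rewrite L2_innerC L2_inner_suml; [|by move=> j; exact/inL2Z/inL2_vareps|exact: inL2_vareps].
rewrite (bigD1_seq i)/= ?mem_index_iota ?i1 ?iota_uniq//.
rewrite L2_innerZl ?L2_inner_vareps// ?eqxx ?mulr1; [|exact: inL2_vareps..].
rewrite big_nat_cond big1 ?addr0 -?expr2// => j /andP[/andP[j1 _] ji].
by rewrite L2_innerZl ?L2_inner_vareps ?(negbTE ji) ?mulr0//; exact: inL2_vareps.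
Qed.

End spectral_solution.

(** * Second moments of the noise *)

Section noise_increments.
Variable R : realType.
Notation mu := (@lebesgue_measure R).
Variables (T : R) (N : nat).
Hypothesis T0 : 0 < T.
Hypothesis N0 : (0 < N)%N.

Let dt := T / N%:R.
Let dt0 : 0 < dt. Proof. by rewrite divr_gt0 ?ltr0n. Qed.

Definition noise_test (i n : nat) (z : R * R) : R :=
  \1_(grid_cell T N n) z.1 * vareps i z.2.

Lemma measurable_noise_test i n (D : set (R * R)) : measurable_fun D (noise_test i n).
Proof.
have mi : measurable_fun setT (\1_(grid_cell T N n) : R -> R).
  by apply: measurable_indic; exact: measurable_itv.
have mv : measurable_fun setT (@vareps R i).
  by apply: continuous_measurable_fun; exact: continuous_vareps.
apply: measurable_funTS; apply: measurable_funM.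
  exact: (measurableT_comp mi measurable_fst).
exact: (measurableT_comp mv measurable_snd).
Qed.

Lemma grid_cell_sub n : (n <= N)%N -> grid_cell T N n `<=` `]0, T[.
Proof.
move=> nN s; rewrite /grid_cell /grid/= !in_itv/= => /andP[a b]; apply/andP; split.
  by apply: le_lt_trans a; rewrite mulr_ge0// ltW.
apply: (lt_le_trans b); rewrite -/dt.
have -> : T = N%:R * dt by rewrite /dt mulrC divfK// pnatr_eq0 -lt0n.
by rewrite ler_pM2r// ler_nat.
Qed.

Lemma integral_noise_test_sqr i n : (0 < i)%N -> (1 <= n <= N)%N ->
  (\int[(mu \x mu)%E]_(z in dom_T T) ((noise_test i n z * noise_test i n z)%:E))%E = dt%:E.
Proof.
move=> i0 /andP[n1 nN]; rewrite integral_mkcond.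
(* A product integrand on the whole plane, ready for Tonelli. In time, no restriction to (0,T) has
   to be added because the grid cell lies inside it. *)
pose F (z : R * R) := ((\1_(grid_cell T N n) z.1)%:E *
   (vareps i z.2 ^+ 2 * \1_(dom R) z.2)%:E)%E.
transitivity (\int[(mu \x mu)%E]_z F z)%E.
  apply: eq_integral => -[s y] _; rewrite patchE /F /noise_test/=.
  case: ifPn => [|].
    rewrite inE => -[/= sT yD]; rewrite [\1_(dom R) y]indicE mem_set//.
    by rewrite -EFinM mulr1 !indicE; case: (_ \in _); rewrite ?mul0r// !mul1r expr2.
  rewrite notin_setE /dom_T/= => H; rewrite !indicE -EFinM.
  have [sc|sc] := boolP (s \in grid_cell T N n); last by rewrite mul0r.
  rewrite (memNset (A := dom R)) ?mulr0// => yD; apply: H; split => //.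
  by apply: (grid_cell_sub nN); rewrite inE in sc.
have mi : measurable_fun setT (fun s : R => (\1_(grid_cell T N n) s : R)%:E).
  by apply/measurable_EFinP; apply: measurable_indic; exact: measurable_itv.
have me : measurable_fun setT (fun y : R => (vareps i y ^+ 2 * \1_(dom R) y)%:E).
  apply/measurable_EFinP; apply: measurable_funM; last first.
    by apply: measurable_indic; exact: measurable_itv.
  apply: measurable_funX; apply: continuous_measurable_fun; exact: continuous_vareps.
rewrite fubini_tonelli1/=; last 2 first.
- apply: emeasurable_funM.
    exact: (measurableT_comp mi measurable_fst).
  exact: (measurableT_comp me measurable_snd).
- by move=> z; rewrite /F mule_ge0// lee_fin mulr_ge0// sqr_ge0.
have inner : (\int[mu]_y (vareps i y ^+ 2 * \1_(dom R) y)%:E = 1)%E.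
  transitivity (\int[mu]_(y in dom R) (vareps i y ^+ 2)%:E)%E.
    rewrite [RHS]integral_mkcond; apply: eq_integral => y _.
    by rewrite patchE indicE; case: ifP => _; rewrite ?mulr1 ?mulr0.
  have hi := @inL2_vareps R i.
  have ii := inL2_sqr_integrable hi.
  rewrite -[LHS]fineK; last by apply: integrable_fin_num ii; exact: measurable_dom.
  congr EFin.
  transitivity (L2_inner (@vareps R i) (vareps i)).
    by apply: eq_Rintegral => y _; rewrite expr2.
  by rewrite L2_inner_vareps// eqxx.
rewrite /fubini_F/F/=.
transitivity (\int[mu]_x (\1_(grid_cell T N n) x : R)%:E)%E.
  apply: eq_integral => s _.
  rewrite ge0_integralZl//= ?inner ?mule1// => y _.
  by rewrite lee_fin mulr_ge0// sqr_ge0.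
rewrite integral_indic//; last exact: measurable_itv.
by rewrite setIT [LHS]lebesgue_measure_grid_cell.
Qed.

Lemma noise_test_inL2_T i n : (0 < i)%N -> (1 <= n <= N)%N -> inL2_T T (noise_test i n).
Proof.
move=> i0 nN; split; first exact: measurable_noise_test.
under eq_integral do rewrite expr2.
by rewrite integral_noise_test_sqr// ltry.
Qed.

Section white_noise.
Context d (Omega : measurableType d) (P : probability Omega R).
Variable W : (R * R -> R) -> {RV P >-> R}.
Hypothesis hW : white_noise T W.

Let xi i n : {RV P >-> R} := noise_incr W T N i n.

(** The increments are centred, so the covariance is the mean of the product, and distinct time
    cells are disjoint. A single mode i is considered because the error has already been split into
    squares mode by mode. *)
Lemma expectation_noise_mul i n k : (0 < i)%N -> (1 <= n <= N)%N -> (1 <= k <= N)%N ->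
  (\int[P]_w (xi i n w * xi i k w)%:E = if n == k then dt%:E else 0)%E.
Proof.
move=> i0 nN kN; case: hW => _ hE hC.
have hn := noise_test_inL2_T i0 nN; have hk := noise_test_inL2_T i0 kN.
have := hC _ _ hn hk; rewrite covariance.unlock hE// hE// /= expectation.unlock => E.
transitivity (\int[(mu \x mu)%E]_(z in dom_T T)
    ((noise_test i n z * noise_test i k z)%:E))%E.
  rewrite -[RHS]E; apply: eq_integral => w _; congr EFin.
  by rewrite mulrfctE /= !subr0.
have [<-|nk] := eqVneq n k; first exact: integral_noise_test_sqr.
rewrite -[RHS](@integral0 _ _ _ (mu \x mu)%E (dom_T T)).
apply: eq_integral => -[s y] _; rewrite /noise_test/=.
have [sn|sn] := boolP (s \in grid_cell T N n); last first.
  by rewrite [\1_(grid_cell T N n) s]indicE (negbTE sn) !mul0r.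
rewrite [\1_(grid_cell T N k) s]indicE memNset ?mul0r ?mulr0// => sk.
move/eqP: nk; apply; rewrite inE in sn.
by apply: (grid_cell_inj T0 N0 _ _ sn sk); [case/andP: nN|case/andP: kN].
Qed.

Lemma integrable_noise_mul i n k : (0 < i)%N -> (1 <= n <= N)%N -> (1 <= k <= N)%N ->
  P.-integrable setT (EFin \o (fun w => xi i n w * xi i k w)).
Proof.
move=> i0 nN kN.
have sq j : (1 <= j <= N)%N -> P.-integrable setT (EFin \o (fun w => xi i j w ^+ 2)).
  move=> jN; apply/integrableP; split.
    by apply/measurable_EFinP; exact: measurable_funX.
  have := expectation_noise_mul i0 jN jN; rewrite eqxx => E.
  rewrite (_ : (\int[P]_w _)%E = dt%:E) ?ltry// -E; apply: eq_integral => w _ /=.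
  by rewrite ger0_norm ?sqr_ge0// expr2.
apply: (@integrable_le _ _ _ P _ _ (fun w => xi i n w ^+ 2 + xi i k w ^+ 2)) => //.
- exact: measurable_funM.
- by apply: integrableRD => //; exact: sq.
- move=> w _; set a := xi i n w; set b := xi i k w.
  rewrite ler_norml; apply/andP; split.
    by have := sqr_ge0 (a + b); have := sqr_ge0 a; have := sqr_ge0 b; nra.
  by have := sqr_ge0 (a - b); have := sqr_ge0 a; have := sqr_ge0 b; nra.
Qed.

Lemma integral_noise_sum_sqr i (c : nat -> R) : (0 < i)%N ->
  (\int[P]_w (((\sum_(1 <= n < N.+1) c n * xi i n w) ^+ 2)%R)%:E =
   (\sum_(1 <= n < N.+1) dt * c n ^+ 2)%R%:E)%E.
Proof.
move=> i0.
pose r n := (1 <= n < N.+1)%N.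
(* Extension by zero: integrability of the products then holds for all indices, as exchanging
   integral and sum requires, whereas the noise moments are known only for 1 <= n <= N. *)
pose Y n w : R := if r n then xi i n w else 0.
have iY n k : P.-integrable setT (fun w => ((c n * c k)%:E * (Y n w * Y k w)%:E)%E).
  apply: integrableZl => //; rewrite /Y.
  case: (boolP (r n)) => rn; last by under eq_fun do rewrite mul0r; exact: integrable0.
  case: (boolP (r k)) => rk; last by under eq_fun do rewrite mulr0; exact: integrable0.
  exact: integrable_noise_mul.
transitivity (\int[P]_w (\sum_(1 <= n < N.+1) \sum_(1 <= k < N.+1)
    (c n * c k)%:E * (Y n w * Y k w)%:E))%E.
  apply: eq_integral => w _.
  rewrite (@eq_big_nat _ _ _ _ _ _ (fun n => c n * Y n w)); last first.
    by move=> n rn; rewrite /Y /r rn.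
  rewrite expr2 mulr_suml -sumEFin.
  apply: eq_bigr => n _; rewrite mulr_sumr -sumEFin.
  by apply: eq_bigr => k _; rewrite -EFinM; congr EFin; ring.
rewrite integral_sum//; last by move=> n; apply: integrable_sum => // k _; exact: iY.
rewrite -sumEFin; apply: eq_big_nat => n rn.
rewrite integral_sum//.
rewrite (bigD1_seq n)/= ?mem_index_iota ?iota_uniq//.
rewrite big_nat_cond big1 ?adde0; last first.
  move=> k /andP[rk kn]; rewrite /Y /r rn rk.
  rewrite integralZl//; last exact: integrable_noise_mul.
  by rewrite expectation_noise_mul// eq_sym (negbTE kn) mule0.
rewrite /Y /r rn integralZl//; last exact: integrable_noise_mul.
by rewrite expectation_noise_mul// eqxx -EFinM mulrC -expr2.
Qed.

End white_noise.
End noise_increments.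

(** * Error estimate *)

Lemma second_moment_bound (R : realType) (T : R) (N Mst M m : nat) : 0 < T ->
    (0 < N)%N -> (0 < M)%N -> (0 < m)%N ->
  \sum_(1 <= i < Mst.+1) \sum_(1 <= n < N.+1)
    (T / N%:R) * kernel_coef T N M m i n ^+ 2 <=
  592 * (T / M%:R) `^ (3 / 4).
Proof.
move=> T0 N0 M0 m0; set tau := T / M%:R.
have tau0 : 0 < tau by rewrite divr_gt0// ltr0n.
have dt0 : 0 < T / N%:R by rewrite divr_gt0// ltr0n.
(* Chosen so that y = i pi del satisfies y^4 = lambda_i^4 tau. The sum over i costs 1/(pi del),
   leaving tau/del = del^3 = tau^(3/4); the factor 1/pi <= 1 is dropped. *)
pose del := tau `^ 4^-1.
have del0 : 0 < del by exact: powR_gt0.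
have del4 : del ^+ 4 = tau.
  by rewrite -powR_mulrn ?ltW// -powRrM mulVf ?powRr1 ?ltW.
have pd0 : 0 < pi * del by rewrite mulr_gt0// pi_gt0.
apply: (@le_trans _ _ (\sum_(1 <= i < Mst.+1)
    592 * tau * ((1 + i%:R * (pi * del)) ^+ 2)^-1)).
  apply: ler_sum_nat => i /andP[i0 _].
  have l0 : 0 < lambda R i ^+ 4 by rewrite exprn_gt0// lambda_gt0.
  have y0 : 0 <= i%:R * (pi * del) by rewrite mulr_ge0// ltW.
  apply: le_trans (cn_kernel_integral_le tau0 l0 m0 y0 _); last first.
    by rewrite mulrA exprMn del4.
  apply: (@indicator_bessel _ _ _ (@lebesgue_measure R) `[0, m%:R * tau[
    (grid_cell T N) (index_iota 1 N.+1) (cn_kernel tau (lambda R i ^+ 4) m) (T / N%:R)) => //.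
  - exact: lebesgue_measure_co_lty.
  - by move=> n; exact: measurable_itv.
  - exact: iota_uniq.
  - move=> n k s; rewrite !mem_index_iota => /andP[n0 _] /andP[k0 _].
    exact: grid_cell_inj.
  - by move=> n; rewrite mem_index_iota => /andP[n0 _]; exact: Rintegral_grid_cell_le.
  - exact: measurable_cn_kernel.
  - have [B HB] := cn_kernel_bounded tau l0 m.
    by exists B => s; rewrite /= in_itv/= => /andP[_ /HB].
rewrite -mulr_sumr; apply: (le_trans (ler_wpM2l _ (sum_invr_sqr_affine_le _ pd0))).
  by apply: mulr_ge0; [exact: ler0n|exact: ltW].
have -> : tau `^ (3 / 4) = del ^+ 3.
  by rewrite -powR_mulrn ?ltW// -powRrM mulrC.
have -> : 592 * tau * (pi * del)^-1 = 592 * (del ^+ 3 * pi^-1).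
  have p0 : 0 < pi :> R := pi_gt0 R.
  rewrite -del4; move: (pi : R) p0 => p p0.
  by field; rewrite !gt_eqF.
apply: ler_wpM2l; first exact: ler0n.
rewrite ler_piMr ?exprn_ge0 ?(ltW del0)//.
by rewrite invf_le1 ?pi_gt0//; have := pi_ge2 R; lra.
Qed.

(** The square root gives tau^(3/8) = tau^(3/8 - eps) tau^eps. As eps <= 1, tau^eps <= (1 + T)^eps
    <= 1 + T and eps^(-1/2) >= 1. *)
Lemma rate_le (R : realType) (T tau eps : R) : 0 < tau -> tau <= T -> 0 < eps ->
    eps <= 3 / 8 ->
  (592 * tau `^ (3 / 4)) `^ 2^-1 <=
  592 `^ 2^-1 * (1 + T) * eps `^ (- 2^-1) * tau `^ (3 / 8 - eps).
Proof.
move=> tau0 tauT e0 e1.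
have T1 : 1 <= 1 + T by lra.
rewrite (powRM _ (ler0n R 592) (powR_ge0 _ _)) -powRrM.
have -> : 3 / 4 * 2^-1 = (3 / 8 - eps) + eps :> R by lra.
rewrite powRD; last by rewrite (gt_eqF tau0) implybT.
move: (592 `^ 2^-1) (powR_ge0 (592 : R) 2^-1) => c c0.
rewrite -2!mulrA; apply: ler_wpM2l => //.
rewrite mulrC mulrA; apply: ler_wpM2r; first exact: powR_ge0.
have te : tau `^ eps <= 1 + T.
  apply: (@le_trans _ _ ((1 + T) `^ eps)).
    by apply: ge0_ler_powR; rewrite ?nnegrE; lra.
  rewrite -[leRHS]powRr1; last by lra.
  by apply: ler_powR => //; lra.
have e2 : 1 <= eps `^ (- 2^-1).
  rewrite powRN invf_ge1 ?powR_gt0//.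
  apply: (@le_trans _ _ (1 `^ 2^-1)); last by rewrite powR1.
  by apply: ge0_ler_powR; rewrite ?nnegrE; lra.
apply: (le_trans te); rewrite ler_peMr//; lra.
Qed.

Theorem theorem4p3 (R : realType) (T : R) (hT : 0 < T)
    (d : measure_display) (Omega : measurableType d) (P : probability Omega R)
    (hP : measure_is_complete P)
    (W : (R * R -> R) -> {RV P >-> R}) (hW : white_noise T W) :
  exists C : R, 0 < C /\
    forall (Mstar Nstar M : nat),
      (0 < Mstar)%N -> (0 < Nstar)%N -> (0 < M)%N ->
      forall U : nat -> Omega -> R -> R,
        crank_nicolson P T M (What W T Mstar Nstar) U ->
        forall eps : R, 0 < eps -> eps <= 3 / 8 ->
          (\big[maxe/-oo]_(1 <= m < M.+1)
             (\int[P]_w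
                (L2_norm (fun x => (U m w x -
                   uhat W T Mstar Nstar w (grid T M m) x)%R) ^+ 2)) `^ 2^-1
           <= (C * eps `^ (- 2^-1) * (T / M%:R) `^ (3 / 8 - eps))%R%:E)%E.
Proof.
exists (592 `^ 2^-1 * (1 + T)); split.
  by apply: mulr_gt0; [apply: powR_gt0; rewrite ltr0n|lra].
move=> Ms N M Ms0 N0 M0 U [U0 US] eps e0 e1.
have tau0 : 0 < T / M%:R by rewrite divr_gt0// ltr0n.
have tauT : T / M%:R <= T by rewrite ler_pdivrMr ?ltr0n// ler_peMr ?ler1n// ltW.
rewrite big_nat_cond; apply: (big_ind (fun z => (z <= _)%E)).
- exact: leNye.
- by move=> a b ha hb; rewrite ge_max ha hb.
move=> m; rewrite andbT ltnS => /andP[m0 mM].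
pose xi i n : {RV P >-> R} := noise_incr W T N i n.
pose H w : R := \sum_(1 <= i < Ms.+1)
  (\sum_(1 <= n < N.+1) kernel_coef T N M m i n * xi i n w) ^+ 2.
have GH : {ae P, forall w, [set: Omega] w -> (H w)%:E =
   (L2_norm (fun x => (U m w x - uhat W T Ms N w (grid T M m) x)%R) ^+ 2)%E}.
  (* One null set for all steps: the diagonalization at step m needs the scheme at every earlier
     step for the same outcome. *)
  have : {ae P, forall w, forall j, (1 <= j <= M)%N -> dotH4 (U j w) /\
      CN_step (What W T Ms N w) (grid T M j.-1) (grid T M j) (U j.-1 w) (U j w)}.
    apply: ae_foralln => j; case: (boolP (1 <= j <= M)%N) => jM.
      by apply: filterS (US j jM) => w.
    by apply: aeW.
  apply: filterS => w VS _; apply/esym.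
  exact: (@error_L2_norm_sqr R T N Ms M hT M0
    (fun n i => xi i n w) (fun j => U j w) (U0 w) VS m mM).
have mH : measurable_fun setT (EFin \o H).
  apply/measurable_EFinP; apply: measurable_sum => i; apply: measurable_funX.
  by apply: measurable_sum => n; exact: measurable_funM.
pose G w := (L2_norm (fun x => (U m w x - uhat W T Ms N w (grid T M m) x)%R) ^+ 2)%E.
(* The scheme imposes no measurability in w on [U]. It is recovered from completeness of [P], since
   the squared error agrees almost surely with the explicit random variable [H]. *)
have mG : measurable_fun setT G := ae_measurable_fun hP GH mH.
rewrite (_ : (\int[P]_w _)%E = (\int[P]_w (EFin \o H) w)%E); last first.
  by apply/esym; apply: ae_eq_integral.
have mi i : measurable_fun setT (fun w =>
    (((\sum_(1 <= n < N.+1) kernel_coef T N M m i n * xi i n w) ^+ 2)%R)%:E).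
  apply/measurable_EFinP; apply: measurable_funX.
  by apply: measurable_sum => n; exact: measurable_funM.
have -> : (\int[P]_w (EFin \o H) w)%E =
    (\sum_(1 <= i < Ms.+1) \sum_(1 <= n < N.+1)
      (T / N%:R) * kernel_coef T N M m i n ^+ 2)%R%:E.
  under eq_integral do rewrite /= /H -sumEFin.
  rewrite ge0_integral_sum//; last by move=> i w _; rewrite lee_fin sqr_ge0.
  rewrite -sumEFin; apply: eq_big_nat => i /andP[i0 _].
  exact: (integral_noise_sum_sqr hT N0 hW).
rewrite poweR_EFin lee_fin; apply: le_trans (rate_le tau0 tauT e0 e1).
apply: ge0_ler_powR; rewrite ?nnegrE.
- by rewrite invr_ge0 ler0n.
- apply: sumr_ge0 => i _; apply: sumr_ge0 => n _.
  by apply: mulr_ge0; [apply: divr_ge0; [exact: ltW|exact: ler0n]|exact: sqr_ge0].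
- by apply: mulr_ge0; [exact: ler0n|exact: powR_ge0].
- exact: second_moment_bound.
Qed.
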